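(* Let $1\le q<p<\infty$ and for each $n$ let $Z=Z_n$ be uniformly distributed in $\mathbb B_p^n$. Then the sequence $(n^{1/p-1/q}\|Z\|_q)_{n\in\mathbb N}$ satisfies an LDP on $\mathbb R$ with speed $n$ and good rate function \[ \mathcal I(z)=\begin{cases}\inf\limits_{z=z_1z_2,\ z_1,z_2\ge0}[\mathcal I_1(z_1)+\mathcal I_2(z_2)] & z\ge0,\\ +\infty & \text{otherwise},\end{cases} \] where $\mathcal I_1(z)=-\log z$ for $z\in(0,1]$ and $\mathcal I_1(z)=+\infty$ otherwise, and \[ \mathcal I_2(z)=\begin{cases}\inf\limits_{x\ge0,\,y>0,\ x^{1/q}y^{-1/p}=z}\Lambda^*(x,y) & z\ge0,\\ +\infty & z<0,\end{cases} \] with $\Lambda^*$ the Legendre–Fenchel transform of \[ \Lambda(t_1,t_2)=\log\int_{\mathbb R}e^{t_1|s|^q+t_2|s|^p}\frac{e^{-|s|^p/p}}{2p^{1/p}\Gamma(1+1/p)}\,ds,\qquad (t_1,t_2)\in\mathbb R^2. \]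
   Context: $\|x\|_p=(\sum_i|x_i|^p)^{1/p}$, $\mathbb B_p^n=\{x\in\mathbb R^n:\|x\|_p\le1\}$. A sequence of real random variables $(X_n)$ satisfies a large deviation principle (LDP) with speed $s(n)\to\infty$ and rate function $\mathcal I:\mathbb R\to[0,\infty]$ (lower semicontinuous) if for every Borel set $A$: $-\inf_{A^\circ}\mathcal I\le\liminf\frac1{s(n)}\log P(X_n\in A)\le\limsup\frac1{s(n)}\log P(X_n\in A)\le-\inf_{\overline A}\mathcal I$; it is good if its level sets $\{\mathcal I\le\alpha\}$ are compact. The Legendre–Fenchel transform is $\Lambda^*(x)=\sup_{u\in\mathbb R^2}[\langle u,x\rangle-\Lambda(u)]$. *)

(* Defs.v *)
From HB Require Import structures.
From mathcomp Require Import all_boot all_order all_algebra.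
From mathcomp Require Import all_classical all_reals all_analysis.
Set Implicit Arguments. Unset Strict Implicit. Unset Printing Implicit Defensive.
Import Order.TTheory GRing.Theory Num.Theory.
Import numFieldNormedType.Exports.
Local Open Scope classical_set_scope.
Local Open Scope ring_scope.

Section Defs.
Variable R : realType.

(* ||x||_r = (sum_i |x_i|^r)^(1/r), vectors of R^n represented as seqs of size n *)
Definition lpnorm (r : R) (s : seq R) : R :=
  (\sum_(x <- s) `|x| `^ r) `^ r^-1.

(* n-dimensional Lebesgue integral of a nonnegative function on R^n, as the
   iterated integral (Tonelli) w.r.t. one-dimensional Lebesgue measure. *)
Fixpoint iint (n : nat) (f : seq R -> \bar R) : \bar R :=
  match n with
  | 0 => f [::]
  | n'.+1 => (\int[@lebesgue_measure R]_x iint n' (fun s => f (x :: s)))%E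
  end.

Definition vol (n : nat) (S : set (seq R)) : \bar R := iint n (fun s => (\1_S s)%:E).

Definition lpball (p : R) : set (seq R) := [set s | lpnorm p s <= 1].

(* law of n^{1/p-1/q} ||Z||_q where Z is uniform on B_p^n:
   P(n^{1/p-1/q} ||Z||_q \in A) = vol(B_p^n \cap {x | n^{1/p-1/q}||x||_q \in A}) / vol(B_p^n) *)
Definition lawZ (p q : R) (n : nat) (A : set R) : \bar R :=
  (vol n [set s | (lpnorm p s <= 1)%R /\ A (n%:R `^ (p^-1 - q^-1) * lpnorm q s)%R]
   * ((fine (vol n (lpball p)))^-1)%:E)%E.

Definition Gamma (x : R) : R :=
  fine (\int[@lebesgue_measure R]_(t in [set t : R | (0 < t)%R]) ((t `^ (x - 1) * expR (- t))%R)%:E)%E.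

Definition pgen_density (p : R) (s : R) : R :=
  expR (- (`|s| `^ p / p)) / (2 * p `^ p^-1 * Gamma (1 + p^-1)).

Definition Lambda (p q : R) (t : R * R) : \bar R :=
  lne (\int[@lebesgue_measure R]_s
         ((expR (t.1 * `|s| `^ q + t.2 * `|s| `^ p) * pgen_density p s)%R)%:E)%E.

Definition Lambda_star (p q : R) (x : R * R) : \bar R :=
  ereal_sup [set ((u.1 * x.1 + u.2 * x.2)%:E - Lambda p q u)%E | u in [set: R * R]].

Definition I1 (z : R) : \bar R :=
  if (0 < z) && (z <= 1) then (- ln z)%:E else +oo%E.

Definition I2 (p q : R) (z : R) : \bar R :=
  if 0 <= z then
    ereal_inf [set Lambda_star p q xy | xy in
      [set xy : R * R | 0 <= xy.1 /\ 0 < xy.2 /\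
                        xy.1 `^ q^-1 * xy.2 `^ (- p^-1) = z]]
  else +oo%E.

Definition Irate (p q : R) (z : R) : \bar R :=
  if 0 <= z then
    ereal_inf [set (I1 zz.1 + I2 p q zz.2)%E | zz in
      [set zz : R * R | 0 <= zz.1 /\ 0 <= zz.2 /\ z = zz.1 * zz.2]]
  else +oo%E.

Definition good_rate_function (I : R -> \bar R) : Prop :=
  [/\ forall x, (0 <= I x)%E,
      lower_semicontinuous I &
      forall a : R, compact [set x | (I x <= a%:E)%E]].

Definition LDP (P : nat -> set R -> \bar R) (s : nat -> R) (I : R -> \bar R) : Prop :=
  forall A : set R, measurable A ->
    (- ereal_inf (I @` (interior A))
       <= limn_einf (fun n => lne (P n A) * ((s n)^-1)%:E)
    /\ limn_esup (fun n => lne (P n A) * ((s n)^-1)%:E)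
       <= - ereal_inf (I @` (closure A)))%E.

End Defs.

(* Main.v *)
Require Import Defs.
From HB Require Import structures.
From mathcomp Require Import all_boot all_order all_algebra.
From mathcomp Require Import all_classical all_reals all_analysis.
From mathcomp Require Import measurable_realfun ring lra.
Set Implicit Arguments. Unset Strict Implicit. Unset Printing Implicit Defensive.
Import Order.TTheory GRing.Theory Num.Theory.
Import numFieldNormedType.Exports.
Local Open Scope classical_set_scope.
Local Open Scope ring_scope.
(* The proof works with the pair of statistics (sum_i |x_i|^q, sum_i |x_i|^p)
   under Lebesgue measure on R^n.  After rescaling by n^(1/p), the event that the
   normalised q-norm lies in A becomes {N_p <= n, (N_q / n)^(1/q) in A}, and its
   Lebesgue volume is estimated by Cramer's method with the partition function
   Z(t) = \int exp (t_1 |s|^q + t_2 |s|^p) ds.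

   Z is infinite when t_2 > 0, so only t_2 <= 0 matters.  Hence the infimum over
   z_1 in the rate function is attained at z_1 = 1, and scaling collapses the
   infimum over (x, y) to y = 1: for z >= 0,
     I(z) = sup_t [t_1 z^q + t_2 - ln Z(t)] + 1/p + ln C,
   where C = Z(0, -1/p) and e^(1/p) C is the exponential growth rate of the volume
   of {N_p <= n}.

   Upper bound: Chernoff's inequality near each point, compactness of [0, 1], and
   a single Chernoff bound on [1, oo[, where the rate is infinite.  Lower bound:
   for x = z^q in ]0, 1[ there is an exponential tilt with mean statistics (x, P),
   where P = 1, or P <= 1 and t_2 = 0; Chebyshev's inequality under this tilt and
   a small contraction bound the exponential cost of the event by
   t_1 x + t_2 - ln Z(t) + 1/p + ln C, which is at most I(z) whether or not t is a
   maximiser. *)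

(** * Functions of the statistics: iterated integrals *)

(** No product measure on R^n is formed. The integrands see a point only through two sums, so n-fold
    integration is the n-th iterate of one operator on functions on the plane, and partition
    functions, variances and dilations are computed by induction on n with a general base point.

    Matching both means of a tilt directly would be a two-dimensional equation for the gradient of
    ln Z. The ratio E|s|^q / (E|s|^p)^(q/p) is invariant under s -> c s, so the problem splits into
    one real equation for this ratio, solved by continuity, and a choice of scale.

    With r = p / q, Bernoulli's inequality |s|^p - r |s|^q + r - 1 >= 0, an equality only at |s| =
    1, is used at both ends: measures concentrating at |s| = 1 have ratio close to 1, so every x < 1
    is reached, and the same parameters (T r, - T) force an infinite rate for x >= 1. *)

Section StatStep.
Context {R : realType}.
Variables (p q : R).
Notation mu := (@lebesgue_measure R).

(* One coordinate of the integral over R^n: [stat_int n g] is the integral of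
   [g (sum_i |x_i|^q, sum_i |x_i|^p)]. *)
Definition stat_step (g : R * R -> \bar R) (v : R * R) : \bar R :=
  (\int[mu]_x g (v.1 + `|x| `^ q, v.2 + `|x| `^ p)%R)%E.

Definition stat_int (n : nat) (g : R * R -> \bar R) : \bar R :=
  iter n stat_step g (0, 0).

Definition nneg_measurable (g : R * R -> \bar R) : Prop :=
  measurable_fun [set: R * R] g /\ forall v, (0 <= g v)%E.

Lemma measurable_normrX (r : R) : measurable_fun [set: R] (fun x : R => `|x| `^ r).
Proof. by apply: measurableT_comp (measurable_powR r) _; exact: normr_measurable. Qed.

Lemma nneg_measurable_comp (g : R * R -> \bar R) (v : R * R) : nneg_measurable g ->
  measurable_fun setT (fun x : R => g (v.1 + `|x| `^ q, v.2 + `|x| `^ p)).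
Proof.
move=> [mg _]; apply: (measurableT_comp mg).
by apply: measurable_fun_pair; apply: measurable_funD => //; exact: measurable_normrX.
Qed.

Lemma nneg_measurable_step (g : R * R -> \bar R) : nneg_measurable g -> nneg_measurable (stat_step g).
Proof.
move=> [mg g0]; split; last by move=> v; exact: integral_ge0.
pose h (z : (R * R) * R) := g (z.1.1 + `|z.2| `^ q, z.1.2 + `|z.2| `^ p).
have mh : measurable_fun [set: (R * R) * R] h.
  have m2 (r : R) : measurable_fun [set: (R * R) * R] (fun z => `|z.2| `^ r).
    by apply: measurableT_comp (measurable_normrX r) _; exact: measurable_snd.
  apply: (measurableT_comp mg); apply: measurable_fun_pair.
    apply: measurable_funD; last exact: m2.
    by apply: measurableT_comp; [exact: measurable_fst | exact: measurable_fst].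
  apply: measurable_funD; last exact: m2.
  by apply: measurableT_comp; [exact: measurable_snd | exact: measurable_fst].
by apply: (@measurable_fun_fubini_tonelli_F _ _ _ _ R mu h mh) => z; exact: g0.
Qed.

Lemma nneg_measurable_iter n (g : R * R -> \bar R) : nneg_measurable g -> nneg_measurable (iter n stat_step g).
Proof. by move=> ng; elim: n => //= n; exact: nneg_measurable_step. Qed.

(** From a base point of the closed quadrant the iteration never leaves it, since each step adds
    nonnegative powers. Hence pointwise comparison is needed on the quadrant only. *)
Lemma le_iter_step n (g h : R * R -> \bar R) : nneg_measurable g -> nneg_measurable h ->
    (forall v, 0 <= v.1 -> 0 <= v.2 -> (g v <= h v)%E) ->
  forall v, 0 <= v.1 -> 0 <= v.2 ->
    (iter n stat_step g v <= iter n stat_step h v)%E.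
Proof.
move=> ng nh gh; elim: n => //= n IH v v1 v2.
apply: ge0_le_integral => //.
- by move=> x _; apply: (nneg_measurable_iter n ng).2.
- by apply: nneg_measurable_comp; exact: nneg_measurable_iter.
- by apply: nneg_measurable_comp; exact: nneg_measurable_iter.
- by move=> x _; apply: IH => /=; rewrite addr_ge0// powR_ge0.
Qed.

Lemma le_stat_int n (g h : R * R -> \bar R) : nneg_measurable g -> nneg_measurable h ->
    (forall v, 0 <= v.1 -> 0 <= v.2 -> (g v <= h v)%E) ->
  (stat_int n g <= stat_int n h)%E.
Proof. by move=> ng nh gh; apply: le_iter_step. Qed.

Lemma eq_stat_int n (g h : R * R -> \bar R) : nneg_measurable g -> nneg_measurable h ->
    (forall v, 0 <= v.1 -> 0 <= v.2 -> g v = h v) ->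
  stat_int n g = stat_int n h.
Proof.
move=> ng nh gh; apply/eqP; rewrite eq_le; apply/andP.
by split; apply: le_stat_int => // v v1 v2; rewrite gh.
Qed.

Lemma stat_int_ge0 n g : nneg_measurable g -> (0 <= stat_int n g)%E.
Proof. by move=> ng; exact: (nneg_measurable_iter n ng).2. Qed.

Lemma nneg_measurableD (g h : R * R -> \bar R) : nneg_measurable g -> nneg_measurable h ->
  nneg_measurable (fun v => g v + h v)%E.
Proof.
by move=> [mg g0] [mh h0]; split; [exact: emeasurable_funD | move=> v; exact: adde_ge0].
Qed.

Lemma nneg_measurableZ (k : R) (g : R * R -> \bar R) : 0 <= k -> nneg_measurable g ->
  nneg_measurable (fun v => k%:E * g v)%E.
Proof.
move=> k0 [mg g0]; split; first exact: measurable_funeM.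
by move=> v; exact: mule_ge0.
Qed.

Lemma nneg_measurable_indic (S : set (R * R)) : measurable S -> nneg_measurable (fun v => (\1_S v)%:E).
Proof.
move=> mS; split; last by move=> v; rewrite lee_fin.
exact/measurable_EFinP/measurable_indic.
Qed.

Lemma stat_intD n (g h : R * R -> \bar R) : nneg_measurable g -> nneg_measurable h ->
  (stat_int n (fun v => g v + h v) = stat_int n g + stat_int n h)%E.
Proof.
move=> ng nh; rewrite /stat_int; elim: n (0, 0) => //= n IH v.
rewrite {1}/stat_step; under eq_integral do rewrite IH.
rewrite ge0_integralD//.
- by move=> x _; apply: (nneg_measurable_iter n ng).2.
- by apply: nneg_measurable_comp; exact: nneg_measurable_iter.
- by move=> x _; apply: (nneg_measurable_iter n nh).2.
- by apply: nneg_measurable_comp; exact: nneg_measurable_iter.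
Qed.

Lemma stat_intZ n (k : R) (g : R * R -> \bar R) : 0 <= k -> nneg_measurable g ->
  (stat_int n (fun v => k%:E * g v) = k%:E * stat_int n g)%E.
Proof.
move=> k0 ng; rewrite /stat_int; elim: n (0, 0) => //= n IH v.
rewrite {1}/stat_step; under eq_integral do rewrite IH.
rewrite ge0_integralZl//.
- by apply: nneg_measurable_comp; exact: nneg_measurable_iter.
- by move=> x _; apply: (nneg_measurable_iter n ng).2.
Qed.

(** Peeling off one coordinate of the iterated integral moves the base point by (|x|^q, |x|^p); the
    induction therefore runs over all base points. *)
Lemma iint_stat n (g : R * R -> \bar R) :
  iint n (fun s => g (\sum_(x <- s) `|x| `^ q, \sum_(x <- s) `|x| `^ p))
    = stat_int n g.
Proof.
rewrite /stat_int.
suff H : forall v : R * R,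
  iint n (fun s => g (v.1 + \sum_(x <- s) `|x| `^ q, v.2 + \sum_(x <- s) `|x| `^ p))
   = iter n stat_step g v.
  rewrite -(H (0, 0)) /=; congr iint; apply/funext => s.
  by rewrite !add0r.
elim: n => [|n IH] v /=; first by rewrite !big_nil !addr0; case: v.
rewrite /stat_step; apply: eq_integral => x _.
rewrite -IH /=; congr iint; apply/funext => s.
by rewrite !big_cons !addrA.
Qed.

(** Linear change of variables: c times the image of [mu] under multiplication by c agrees with [mu]
    on half-open intervals, hence everywhere by uniqueness of Lebesgue measure. *)
Lemma integral_scale (c : R) (f : R -> \bar R) : 0 < c ->
    measurable_fun setT f -> (forall x, (0 <= f x)%E) ->
  (\int[mu]_x f (c * x)%R = c^-1%:E * \int[mu]_x f x)%E.
Proof.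
move=> c0 mf f0.
have mc : measurable_fun [set: measurableTypeR R]
    ( *%R c : measurableTypeR R -> measurableTypeR R).
  exact: measurable_funM.
have cN : 0 <= c^-1 by rewrite invr_ge0 ltW.
pose nu := pushforward mu ( *%R c : _ -> measurableTypeR R).
have H (A : set R) : measurable A -> mu A = (c%:E * nu A)%E.
  apply: (@lebesgue_measure_unique R (mscale (NngNum (ltW c0)) nu)) => //= _ [[a b]] _ <-.
  rewrite /mscale/= /pushforward.
  have -> : *%R c @^-1` `]a, b] = `]c^-1 * a, c^-1 * b]%classic.
    apply/seteqP; split=> x /=; rewrite !in_itv/=;
      by rewrite -!(ler_pM2l c0 x) -!(ltr_pM2l c0 _ x) !mulrA mulfV ?gt_eqF// !mul1r.
  rewrite !lebesgue_measure_itv/= !lte_fin ltr_pM2l ?invr_gt0//.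
  case: ifP => _; last by rewrite mule0.
  by rewrite -EFinB -EFinM -mulrBr mulrA mulfV ?gt_eqF// mul1r.
transitivity (\int[pushforward mu ( *%R c : _ -> measurableTypeR R)]_x f x)%E.
  by rewrite ge0_integral_pushforward.
rewrite -(@ge0_integral_mscale _ _ _ mu setT measurableT (NngNum cN) f)//.
apply: eq_measure_integral => A mA _.
by rewrite /= /mscale/= H// muleA -EFinM mulVf ?mul1e// gt_eqF.
Qed.

Lemma stat_int_scale n (c : R) (g : R * R -> \bar R) : 0 < c -> nneg_measurable g ->
  (stat_int n (fun v => g (c `^ q * v.1, c `^ p * v.2)%R)
    = (c^-1 ^+ n)%:E * stat_int n g)%E.
Proof.
move=> c0 ng; rewrite /stat_int.
suff H : forall v : R * R,
    (iter n stat_step (fun v => g (c `^ q * v.1, c `^ p * v.2)%R) v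
     = (c^-1 ^+ n)%:E * iter n stat_step g (c `^ q * v.1, c `^ p * v.2)%R)%E.
  by rewrite H /= !mulr0.
elim: n => [|n IH] v /=; first by rewrite mul1e.
rewrite {1}/stat_step; under eq_integral do rewrite IH /= !mulrDr.
rewrite ge0_integralZl//; first last.
- by rewrite lee_fin exprn_ge0// invr_ge0 ltW.
- by move=> x _; apply: (nneg_measurable_iter n ng).2.
- apply: (measurableT_comp (nneg_measurable_iter n ng).1).
  apply: measurable_fun_pair; apply: measurable_funD => //;
  by apply: measurable_funM => //; exact: measurable_normrX.
rewrite exprSr EFinM -muleA; congr (_ * _)%E.
rewrite /stat_step -integral_scale//; first last.
- by move=> x; apply: (nneg_measurable_iter n ng).2.
- exact: (@nneg_measurable_comp _ (_, _) (nneg_measurable_iter n ng)).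
apply: eq_integral => x _ /=.
by rewrite normrM (gtr0_norm c0) !powRM// ltW.
Qed.

End StatStep.

(** * Inequalities for real powers *)

Section Growth.
Context {R : realType}.

(** [U] is where |a| u^al and b u^be cross: below it the left side is at most |a| U^al, above it the
    higher power wins. *)
Lemma powR_growth (a b al be : R) : 0 <= al -> al < be -> 0 < b ->
  exists2 C, 0 <= C & forall u : R, 0 <= u -> a * u `^ al <= b * u `^ be + C.
Proof.
move=> al0 albe b0.
pose U := (`|a| / b) `^ (be - al)^-1.
exists (`|a| * U `^ al) => [|u u0]; first by rewrite mulr_ge0// powR_ge0.
apply: (@le_trans _ _ (`|a| * u `^ al)).
  by rewrite ler_wpM2r ?powR_ge0 ?ler_norm.
have [uU|Uu] := leP u U.
  apply: (@le_trans _ _ (`|a| * U `^ al)); last first.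
    by rewrite lerDr mulr_ge0 ?powR_ge0// ltW.
  by rewrite ler_wpM2l// ge0_ler_powR// nnegrE ?powR_ge0.
have u1 : 0 < u by rewrite (le_lt_trans _ Uu)// powR_ge0.
apply: (@le_trans _ _ (b * u `^ be)); last by rewrite lerDl mulr_ge0// powR_ge0.
have -> : u `^ be = u `^ (be - al) * u `^ al.
  by rewrite -powRD ?subrK// (gt_eqF u1) implybT.
rewrite mulrA ler_wpM2r ?powR_ge0//.
rewrite mulrC -ler_pdivrMr//.
have -> : `|a| / b = U `^ (be - al).
  have bal : be - al != 0 by rewrite gt_eqF// subr_gt0.
  by rewrite -powRrM mulVf// powRr1// divr_ge0// ltW.
by rewrite ge0_ler_powR ?nnegrE ?powR_ge0 ?subr_ge0 ?ltW.
Qed.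

(** Raise v <= exp v, with v = e u / k, to the power k. The division by k is why k = 0 is
    separate. *)
Lemma powR_le_expR (k e : R) : 0 <= k -> 0 < e ->
  exists2 C, 0 <= C & forall u : R, 0 <= u -> u `^ k <= C * expR (e * u).
Proof.
move=> k0 e0.
have [->|kn0] := eqVneq k 0.
  exists 1 => // u u0; rewrite powRr0 mul1r.
  by rewrite -expR0 ler_expR mulr_ge0// ltW.
have kp : 0 < k by rewrite lt_neqAle eq_sym kn0.
exists ((k / e) `^ k) => [|u u0]; first exact: powR_ge0.
have -> : u = (k / e) * (e * u / k) by field; rewrite gt_eqF//= gt_eqF.
rewrite powRM; [|by rewrite divr_ge0// ltW|by rewrite divr_ge0// mulr_ge0// ltW].
rewrite ler_wpM2l ?powR_ge0//.
have -> : expR (e * (k / e * (e * u / k))) = expR (e * u / k) `^ k.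
  by rewrite -expRM; congr expR; field; rewrite gt_eqF//= gt_eqF.
rewrite ge0_ler_powR ?nnegrE ?expR_ge0//; first by rewrite divr_ge0// mulr_ge0// ltW.
by apply: le_trans (expR_ge1Dx _); rewrite lerDr.
Qed.

Lemma le_1DpowR (r u : R) : 1 <= r -> 0 <= u -> u <= 1 + u `^ r.
Proof.
move=> r1 u0; have [u1|u1] := leP u 1.
  by rewrite (le_trans u1)// lerDl powR_ge0.
apply: (@le_trans _ _ (u `^ r)); last by rewrite lerDr.
by rewrite -{1}(powRr1 u0) ler_powR// ltW.
Qed.

(** Bernoulli's inequality, v^r lying above its tangent at 1. Strictness away from 1 is what later
    makes [phi] vanish only at |s| = 1. *)
Lemma bernoulli_powR (r v : R) : 1 < r -> 0 <= v -> v != 1 ->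
  r * v < v `^ r + r - 1.
Proof.
move=> r1 v0 v1; have [->|vn0] := eqVneq v 0.
  by rewrite powR0 ?mulr0; lra.
have vp : 0 < v by rewrite lt_neqAle eq_sym vn0.
have r0 : 0 < r by lra.
set w := ln v.
have ve : v = expR w by rewrite lnK// posrE.
have we : v `^ r = expR (r * w) by rewrite mulrC expRM -ve.
have w0 : w != 0 by apply: contra_neq v1 => w0; rewrite ve w0 expR0.
(* Weighted AM-GM for [v ^ r] and [1], through [1 + x < exp x]. *)
pose m := ln (r^-1 * v `^ r + (1 - r^-1)).
have ri : 0 < r^-1 < 1 by rewrite invr_gt0 r0 invf_lt1.
have mp : 0 < r^-1 * v `^ r + (1 - r^-1).
  by rewrite addr_gt0 ?mulr_gt0 ?powR_gt0//; lra.
have em : expR m = r^-1 * v `^ r + (1 - r^-1) by rewrite lnK// posrE.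
have h1 : 1 + (r * w - m) <= expR (r * w - m) by exact: expR_ge1Dx.
have h2 : 1 + (- m) <= expR (- m) by exact: expR_ge1Dx.
have h12 : r^-1 * (1 + (r * w - m)) + (1 - r^-1) * (1 + (- m)) <
   r^-1 * expR (r * w - m) + (1 - r^-1) * expR (- m).
  (* Since [w] is nonzero, [m] and [r * w - m] do not both vanish, so one of [h1], [h2] is
     strict. *)
  have [m0|m0] := eqVneq m 0.
    apply: ltr_leD; last by rewrite ler_wpM2l//; lra.
    by rewrite ltr_pM2l ?invr_gt0// expR_gt1Dx// m0 subr0 mulf_neq0// gt_eqF.
  apply: ler_ltD; first by rewrite ler_pM2l// invr_gt0.
  by rewrite ltr_pM2l ?expR_gt1Dx ?oppr_eq0//; lra.
have E : r^-1 * expR (r * w - m) + (1 - r^-1) * expR (- m) = 1.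
  rewrite expRD -we; transitivity ((r^-1 * v `^ r + (1 - r^-1)) * expR (- m)); first ring.
  by rewrite -em -expRD subrr expR0.
have wm : w < m.
  have -> : w = r^-1 * (r * w) by rewrite mulrA mulVf ?mul1r// gt_eqF.
  move: h12; rewrite E; nra.
have : r * v < r * expR m by rewrite ltr_pM2l// ve ltr_expR.
by rewrite em mulrDr mulrA mulfV ?gt_eqF// mul1r mulrBr mulfV ?gt_eqF// mulr1 addrA.
Qed.

Lemma powR_le_root (p x y : R) : 0 < p -> 0 <= x -> 0 <= y -> (x `^ p <= y) = (x <= y `^ p^-1).
Proof.
move=> p0 x0 y0; have pn : p != 0 by rewrite gt_eqF.
apply/idP/idP => h.
  have -> : x = (x `^ p) `^ p^-1 by rewrite -powRrM mulfV// powRr1.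
  by rewrite ge0_ler_powR ?nnegrE ?powR_ge0// invr_ge0 ltW.
have -> : y = (y `^ p^-1) `^ p by rewrite -powRrM mulVf// powRr1.
by rewrite ge0_ler_powR ?nnegrE ?powR_ge0// ltW.
Qed.

Lemma powRVl (c k : R) : 0 <= c -> c^-1 `^ k = (c `^ k)^-1.
Proof. by move=> c0; rewrite -(powR_inv1 c0) powRAC powR_inv1// powR_ge0. Qed.

End Growth.

(** * The partition function *)

Section ExpWeight.
Context {R : realType}.
Notation mu := (@lebesgue_measure R).

Definition ew (p q : R) (t : R * R) (x : R) : R :=
  expR (t.1 * `|x| `^ q + t.2 * `|x| `^ p).

(* The parameters for which the partition function [Zint] is finite. *)
Definition admissible (t : R * R) : Prop := t.2 < 0 \/ (t.2 = 0 /\ t.1 < 0).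

Definition Zint (p q : R) (t : R * R) : \bar R := (\int[mu]_x (ew p q t x)%:E)%E.

Lemma integrable_expN (l : R) : 0 < l ->
  mu.-integrable setT (EFin \o (fun x : R => expR (- l * `|x|))).
Proof.
move=> l0; apply/integrableP; split.
  have : measurable_fun [set: R] (fun x : R => expR (- l * `|x|)).
    apply: (measurableT_comp (@measurable_expR R)).
    by apply: measurable_funM => //; exact: normr_measurable.
  by move=> mE; exact/measurable_EFinP.
under eq_integral => x _ do rewrite /= ger0_norm ?expR_ge0//.
rewrite (@ge0_symfun_integralT R (fun x => expR (- l * `|x|))).
- have -> : (\int[mu]_(x in [set x | (0 <= x)%R]) (expR (- l * `|x|))%:E =
      \int[mu]_(x in [set x | (0 <= x)%R]) (l^-1%:E * (exponential_pdf l x)%:E))%E.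
    apply: eq_integral => x; rewrite inE /= => x0.
    by rewrite exponential_pdfE// ger0_norm// -EFinM mulrA mulVf ?mul1r// gt_eqF.
  have mS : measurable [set x : R | 0 <= x].
    have -> : [set x : R | 0 <= x] = `[0, +oo[%classic.
      by apply/seteqP; split => x /=; rewrite in_itv/= andbT.
    exact: measurable_itv.
  have mE D : measurable_fun D (fun x => (exponential_pdf l x)%:E).
    by apply/measurable_EFinP; apply: measurable_funTS; exact: measurable_exponential_pdf.
  have pE x : (0 <= (exponential_pdf l x)%:E)%E by rewrite lee_fin exponential_pdf_ge0// ltW.
  rewrite ge0_integralZl//; last by rewrite lee_fin invr_ge0 ltW.
  rewrite muleA; apply: (@le_lt_trans _ _ (2%:E * l^-1%:E * \int[mu]_x (exponential_pdf l x)%:E)%E).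
    apply: lee_wpmul2l; first by rewrite -EFinM lee_fin mulr_ge0// invr_ge0 ltW.
    by apply: ge0_subset_integral => //; exact: mE.
  by rewrite integral_exponential_pdf// mule1 ltry.
- exact: mE.
- by move=> x; exact: expR_ge0.
- move=> x; apply: (@continuous_comp _ _ _ (fun x => - l * `|x|) expR); last exact: continuous_expR.
  apply: continuousM; first exact: cst_continuous.
  exact: norm_continuous.
- by move=> x /=; rewrite normrN.
Qed.

Lemma ew_ge0 p q t x : 0 <= ew p q t x. Proof. exact: expR_ge0. Qed.

Lemma measurable_ew p q t : measurable_fun [set: R] (ew p q t).
Proof.
apply: (measurableT_comp (@measurable_expR R)).
by apply: measurable_funD; apply: measurable_funM => //; exact: measurable_normrX.
Qed.

Variables p q : R.
Hypotheses (q1 : 1 <= q) (qp : q < p).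

Lemma ew_le (t : R * R) : admissible t -> exists C l : R, [/\ 0 <= C, 0 < l &
  forall x : R, ew p q t x <= C * expR (- l * `|x|)].
Proof.
have q0 : 0 <= q := le_trans ler01 q1.
case=> [t2|[t2 t1]].
  have t2' : 0 < - t.2 by lra.
  (* The added 1 leaves a spare term - |x|^q in the exponent, which [le_1DpowR] turns into linear
     decay. *)
  have [C C0 HC] := @powR_growth R (t.1 + 1) (- t.2) q p q0 qp t2'.
  exists (expR (C + 1)), 1; split; rewrite ?expR_ge0//.
  move=> x; rewrite -expRD ler_expR.
  have := HC _ (normr_ge0 x); have := le_1DpowR q1 (normr_ge0 x); lra.
exists (expR (- t.1)), (- t.1); split; [exact: expR_ge0|lra|move=> x].
rewrite -expRD ler_expR t2 opprK.
have := le_1DpowR q1 (normr_ge0 x); nra.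
Qed.

Lemma integrable_moment (k : R) (t : R * R) : 0 <= k -> admissible t ->
  mu.-integrable setT (EFin \o (fun x : R => `|x| `^ k * ew p q t x)).
Proof.
move=> k0 /ew_le[C [l [C0 l0 H]]].
(* Half of the decay rate absorbs |x|^k; the other half keeps the bound integrable. *)
have l2 : 0 < l / 2 by lra.
have [C' C'0 H'] := powR_le_expR k0 l2.
apply: (@le_integrable _ _ _ mu setT measurableT _ (EFin \o (fun x : R => C' * C * expR (- (l / 2) * `|x|)))).
- apply/measurable_EFinP; apply: measurable_funM; first exact: measurable_normrX.
  exact: measurable_ew.
- move=> x _ /=; rewrite lee_fin [leLHS]ger0_norm ?mulr_ge0 ?powR_ge0 ?expR_ge0//.
  rewrite [leRHS]ger0_norm ?mulr_ge0 ?expR_ge0//.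
  have -> : C' * C * expR (- (l / 2) * `|x|) = (C' * expR (l / 2 * `|x|)) * (C * expR (- l * `|x|)).
    rewrite mulrACA -expRD; congr (_ * expR _); lra.
  by apply: ler_pM; rewrite ?powR_ge0 ?ew_ge0//; exact: H'.
- have := @integrableZl _ _ _ mu setT measurableT (C' * C) _ (integrable_expN l2).
  by congr (_.-integrable _ _); apply/funext => x.
Qed.

Lemma integrable_ew (t : R * R) : admissible t ->
  mu.-integrable setT (EFin \o ew p q t).
Proof.
move=> /(integrable_moment (lexx 0)).
by congr (_.-integrable _ _); apply/funext => x /=; rewrite powRr0 mul1r.
Qed.

Lemma Zint_fin (t : R * R) : admissible t -> Zint p q t \is a fin_num.
Proof. by move=> /integrable_ew; exact: integrable_fin_num. Qed.

Lemma Zint_gt0 (t : R * R) : (0 < Zint p q t)%E.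
Proof.
pose d := expR (- `|t.1| - `|t.2|).
apply: (@lt_le_trans _ _ (\int[mu]_(x in `[0%R, 1%R]) (d%:E))%E).
  rewrite integral_cst//= lebesgue_measure_itv/= lte_fin ltr01 oppr0 adde0 mule1.
  by rewrite lte_fin expR_gt0.
apply: (@le_trans _ _ (\int[mu]_(x in `[0%R, 1%R]) (ew p q t x)%:E)%E).
  apply: ge0_le_integral => //.
  - by move=> x _; rewrite lee_fin expR_ge0.
  - by apply: measurable_funTS; apply/measurable_EFinP; exact: measurable_ew.
  move=> x; rewrite /= in_itv/= => /andP[x0 x1]; rewrite lee_fin ler_expR.
  have H (r s : R) : 0 <= r -> - `|s| <= s * `|x| `^ r.
    move=> r0; have h1 : `|x| `^ r <= 1.
      rewrite -[leRHS](congr1 (@^~ r) (@powR1 R)) ge0_ler_powR ?nnegrE//; by rewrite ger0_norm.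
    have h0 := powR_ge0 `|x| r.
    have : - `|s| <= s by rewrite lerNl -normrN ler_norm.
    have : 0 <= `|s| by []. 
    nra.
  have q0 : 0 <= q := le_trans ler01 q1.
  by rewrite lerD// H// (le_trans q0)// ltW.
apply: ge0_subset_integral => //.
- by apply/measurable_EFinP; exact: measurable_ew.
- by move=> x _; rewrite lee_fin expR_ge0.
Qed.

Lemma Zint_pinfty (t : R * R) : 0 < t.2 -> Zint p q t = +oo%E.
Proof.
move=> t2.
have [C C0 HC] := @powR_growth R (- t.1) t.2 q p (le_trans ler01 q1) qp t2.
apply/eqP; rewrite -leye_eq.
apply: (@le_trans _ _ (\int[mu]_x (expR (- C))%:E)%E).
  rewrite integral_cst//.
  rewrite [X in (_ * X)%E](_ : _ = +oo%E); last by have := @lebesgue_measure_itv R `]-oo, +oo[; rewrite set_itvNyy.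
  by rewrite gt0_muley// lte_fin expR_gt0.
apply: ge0_le_integral => //.
- by apply/measurable_EFinP; exact: measurable_ew.
- move=> x _; rewrite lee_fin ler_expR.
  have := HC _ (normr_ge0 x); lra.
Qed.

Lemma admissible_scale (c : R) (t : R * R) : 0 < c -> admissible t ->
  admissible (c `^ q * t.1, c `^ p * t.2).
Proof.
move=> c0 [h|[h1 h2]]; [left|right] => /=; first by rewrite pmulr_rlt0 ?powR_gt0.
by rewrite h1 mulr0 pmulr_rlt0 ?powR_gt0.
Qed.

Lemma Zint_scale (c : R) (t : R * R) : 0 < c ->
  Zint p q (c `^ q * t.1, c `^ p * t.2) = (c^-1%:E * Zint p q t)%E.
Proof.
move=> c0.
have mE : measurable_fun [set: R] (fun x => (ew p q t x)%:E).
  by apply/measurable_EFinP; exact: measurable_ew.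
rewrite /Zint -(integral_scale c0 mE) => [|x]; last by rewrite lee_fin expR_ge0.
apply: eq_integral => x _; congr (_%:E).
rewrite /ew/= normrM (gtr0_norm c0) !powRM// ?ltW//.
by congr expR; rewrite !mulrA ![_ * t.1]mulrC ![_ * t.2]mulrC.
Qed.

End ExpWeight.

(** * The partition function at (0, -1/p) and the Gamma function *)

Section Normalization.
Context {R : realType}.
Notation mu := (@lebesgue_measure R).

Lemma integral_expN_tail (a : R) :
  (\int[mu]_(u in `[a, +oo[) (expR (- u))%:E = (expR (- a))%:E)%E.
Proof.
have cE : continuous (fun u : R => expR (- u)).
  move=> u; apply: (@continuous_comp _ _ _ (fun u : R => - u) expR).
    exact: opp_continuous.
  exact: continuous_expR.
rewrite (@ge0_continuous_FTC2y _ _ (fun x => - (expR (- x))) _ 0)//.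
- by rewrite EFinN oppeK add0e.
- exact: continuous_subspaceT.
- by rewrite -oppr0; apply: cvgN; exact: cvgr_expR.
- by apply: cvgN; apply/cvg_at_right_filter; exact: cE.
- move=> x _.
  rewrite derive1_comp// derive1N// derive1_id mulN1r derive1_comp// derive1E.
  have /funeqP -> := @derive_expR R.
  by rewrite derive1N// derive1_id mulrN mulr1 opprK.
Qed.

Lemma integral_itv_sym (r : R) : 0 <= r ->
  mu `[- r, r]%classic = (2 * r)%:E.
Proof.
move=> r0; rewrite lebesgue_measure_itv/= lte_fin.
case: ltP => h; first by rewrite -EFinB; congr (_%:E); lra.
have -> : r = 0 by lra.
by rewrite mulr0.
Qed.

Variables p q : R.
Hypotheses (q1 : 1 <= q) (qp : q < p).

Let p0 : 0 < p := le_lt_trans (le_trans ler01 q1) qp.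

(* Tonelli, after writing exp (- |s|^p / p) as the integral of exp (- u) over
   u >= |s|^p / p. *)
Lemma Zint_Gamma : Zint p q (0, - p^-1) = (2 * p `^ p^-1 * Gamma (1 + p^-1))%:E.
Proof.
have pn : p != 0 by rewrite gt_eqF.
have pV : 0 < p^-1 by rewrite invr_gt0.
pose G (z : R * R) : \bar R := (expR (- z.2) * \1_[set z : R * R | `|z.1| `^ p <= p * z.2] z)%:E.
have mG : measurable_fun [set: R * R] G.
  apply/measurable_EFinP; apply: measurable_funM.
    apply: (measurableT_comp (@measurable_expR R)).
    by apply: measurable_funN; exact: measurable_snd.
  apply: measurable_indic; rewrite -[X in measurable X]setTI.
  apply: (@measurable_fun_ler _ _ _ _ (fun z : R * R => `|z.1| `^ p) (fun z => p * z.2)) => //.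
    by apply: (measurableT_comp (measurable_normrX p)); exact: measurable_fst.
  by apply: measurable_funM => //; exact: measurable_snd.
have G0 z : (0 <= G z)%E by rewrite lee_fin mulr_ge0 ?expR_ge0.
have := @fubini_tonelli _ _ _ _ R mu mu G mG G0.
have -> : (\int[mu]_x \int[mu]_y G (x, y) = Zint p q (0%R, (- p^-1)%R))%E.
  apply: eq_integral => x _.
  transitivity (\int[mu]_(u in `[(`|x| `^ p / p)%R, +oo[) (expR (- u))%:E)%E.
    rewrite [RHS]integral_mkcond; apply: eq_integral => u _.
    rewrite patchE /G indicE/=.
    have -> : ((x, u) \in [set z : R * R | `|z.1| `^ p <= p * z.2]) =
        (u \in (`[`|x| `^ p / p, +oo[%classic : set R)).
      apply/idP/idP; rewrite !inE/= in_itv/= andbT ler_pdivrMr// mulrC//.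
    by case: ifP => _; rewrite ?mulr1 ?mulr0.
  rewrite integral_expN_tail; congr (expR _)%:E => /=; lra.
have -> : (\int[mu]_y \int[mu]_x G (x, y) =
   (2 * p `^ p^-1)%:E * \int[mu]_(t in [set t : R | (0 < t)%R]) ((t `^ (1 + p^-1 - 1) * expR (- t))%R)%:E)%E.
  have mS : measurable [set t : R | 0 < t].
    have -> : [set t : R | 0 < t] = `]0, +oo[%classic.
      by apply/seteqP; split => x /=; rewrite in_itv/= andbT.
    exact: measurable_itv.
  rewrite -ge0_integralZl//=; last 3 first.
  - apply/measurable_EFinP; apply: measurable_funTS; apply: measurable_funM.
      exact: measurable_powR.
    by apply: (measurableT_comp (@measurable_expR R)); exact: oppr_measurable.
  - by move=> t _; rewrite lee_fin mulr_ge0 ?powR_ge0 ?expR_ge0.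
  - by rewrite lee_fin mulr_ge0 ?powR_ge0.
  rewrite [RHS]integral_mkcond; apply: eq_integral => u _.
  rewrite patchE.
  have [u0|u0] := ltP 0 u.
    rewrite mem_set//=.
    pose S : set R := `[- (p * u) `^ p^-1, (p * u) `^ p^-1]%classic.
    transitivity (\int[mu]_(x in S) (expR (- u))%:E)%E.
      rewrite [RHS]integral_mkcond; apply: eq_integral => x _.
      rewrite patchE /G indicE/=.
      have -> : ((x, u) \in [set z : R * R | `|z.1| `^ p <= p * z.2]) =
        (x \in S).
        apply/idP/idP; rewrite !inE/= /S /= in_itv/= powR_le_root// ?ler_norml//;
        by rewrite mulr_ge0// ltW.
      by case: ifP => _; rewrite ?mulr1 ?mulr0.
    transitivity ((expR (- u))%:E * mu S)%E.
      by rewrite integral_cst//; exact: measurable_itv.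
    have -> : mu S = (2 * (p * u) `^ p^-1)%:E by apply: integral_itv_sym; exact: powR_ge0.
    rewrite -!EFinM; congr (_%:E).
    rewrite powRM ?(ltW u0)// ?(ltW p0)// (addrC 1) addrK; ring.
  rewrite memNset/=; last by apply/negP; rewrite -leNgt.
  (* For u <= 0 the slice lies in {0}, a null set. *)
  suff H : (\int[mu]_x G (x, u) <= (expR (- u))%:E * mu [set (0 : R)%R])%E.
    move: H; rewrite lebesgue_measure_set1 mule0 => H.
    by apply/eqP; rewrite eq_le; apply/andP; split => //; exact: integral_ge0.
  rewrite -integral_cst// [leRHS]integral_mkcond; apply: ge0_le_integral => //.
  - exact: measurable_fun_pair1.
  - by apply/(measurable_restrictT _ _).1 => //; exact: measurable_cst.
  move=> x _; rewrite patchE /G indicE/=; case: ifPn => h.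
    by rewrite lee_fin; case: (_ \in _); rewrite ?mulr1 ?mulr0 ?expR_ge0.
  rewrite memNset ?mulr0//= => h'; move/negP: h; apply; rewrite inE/=.
  have : `|x| `^ p <= 0 by rewrite (le_trans h')// pmulr_rle0.
  by rewrite le_eqVlt ltNge powR_ge0 orbF powR_eq0 normr_eq0 => /andP[/eqP].
move=> E; rewrite E /Gamma.
(* [Gamma] is defined through [fine]; finiteness of its integral is deduced from that of [Zint]. *)
have : Zint p q (0, - p^-1) \is a fin_num.
  by apply: Zint_fin => //; left; rewrite oppr_lt0.
rewrite E; set I := (\int[mu]_(t in _) _)%E.
have : (0 <= I)%E by apply: integral_ge0 => t _; rewrite lee_fin mulr_ge0 ?powR_ge0 ?expR_ge0.
by case: I => [r||]//= _; rewrite gt0_muley// lte_fin mulr_gt0 ?powR_gt0.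
Qed.

Lemma Gamma_gt0 : 0 < 2 * p `^ p^-1 * Gamma (1 + p^-1).
Proof. by rewrite -lte_fin -Zint_Gamma; exact: Zint_gt0. Qed.

End Normalization.

(** * Real-valued moments of the exponential weights *)

Section Moments.
Context {R : realType}.
Notation mu := (@lebesgue_measure R).

Definition intg (f : R -> R) := mu.-integrable setT (EFin \o f).
Definition Rint (f : R -> R) : R := (\int[mu]_x f x)%R.

Lemma intgD f g : intg f -> intg g -> intg (fun x => f x + g x).
Proof. by move=> hf hg; exact: (integrableD measurableT hf hg). Qed.

Lemma intgZ (a : R) f : intg f -> intg (fun x => a * f x).
Proof. by move=> hf; exact: (integrableZl measurableT a hf). Qed.

Lemma RintD f g : intg f -> intg g -> Rint (fun x => f x + g x) = Rint f + Rint g.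
Proof. by move=> hf hg; exact: RintegralD. Qed.

Lemma RintZ (a : R) f : intg f -> Rint (fun x => a * f x) = a * Rint f.
Proof. by move=> hf; exact: RintegralZl. Qed.

Lemma le_Rint f g : intg f -> intg g -> (forall x, f x <= g x) -> Rint f <= Rint g.
Proof. by move=> hf hg fg; apply: le_Rintegral. Qed.

Lemma eq_Rint f g : (forall x, f x = g x) -> Rint f = Rint g.
Proof. by move=> fg; apply: eq_Rintegral => x _. Qed.

Lemma Rint_indic (a b : R) : a <= b -> Rint (\1_(`[a, b]%classic : set R)) = b - a.
Proof.
move=> ab; rewrite /Rint /Rintegral integral_indic//=.
rewrite setIT lebesgue_measure_itv/= lte_fin.
by move: ab; rewrite le_eqVlt => /predU1P[->|->]; rewrite ?ltxx ?subrr//= -EFinB.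
Qed.

Lemma intg_indic (a b : R) : intg (\1_(`[a, b]%classic : set R)).
Proof.
exact: integrable_indic_itv.
Qed.

Variables p q : R.
Hypotheses (q1 : 1 <= q) (qp : q < p).

Let q0 : 0 < q := lt_le_trans ltr01 q1.
Let p0 : 0 < p := lt_trans q0 qp.

Definition mom (k : R) (t : R * R) : R := Rint (fun x => `|x| `^ k * ew p q t x).

Lemma intg_mom k t : 0 <= k -> admissible t -> intg (fun x => `|x| `^ k * ew p q t x).
Proof. exact: integrable_moment. Qed.

Lemma EFin_mom k t : 0 <= k -> admissible t ->
  ((mom k t)%:E = \int[mu]_x (`|x| `^ k * ew p q t x)%:E)%E.
Proof.
by move=> k0 ad; rewrite /mom /Rint /Rintegral fineK//; exact: (integrable_fin_num _ (intg_mom k0 ad)).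
Qed.

Lemma mom0E t : admissible t -> (mom 0 t)%:E = Zint p q t.
Proof.
by move=> ad; rewrite EFin_mom//; apply: eq_integral => x _; rewrite powRr0 mul1r.
Qed.

Lemma mom_gt0 k t : 0 <= k -> admissible t -> 0 < mom k t.
Proof.
move=> k0 ad.
(* On [1, 2] both |x|^q and |x|^p are between 1 and 2^p, so the weight is at least [d] there. *)
pose d := expR (- (2 `^ p * (`|t.1| + `|t.2|))).
have d0 : 0 < d by exact: expR_gt0.
have H : intg (fun x => d * \1_(`[1%R, 2%R]%classic : set R) x).
  by apply: intgZ; exact: intg_indic.
have : Rint (fun x => d * \1_(`[1%R, 2%R]%classic : set R) x) <= mom k t.
  apply: le_Rint => //; first exact: intg_mom.
  move=> x; rewrite indicE; have [|_] := boolP (x \in _); last first.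
    by rewrite mulr0 mulr_ge0 ?powR_ge0 ?ew_ge0.
  rewrite inE/= in_itv/= mulr1 => /andP[x1 x2].
  rewrite ger0_norm; last by lra.
  have A r : 0 <= r -> 1 <= x `^ r.
    by move=> r0; rewrite -(powRr0 x) ler_powR.
  have B r : 0 <= r -> r <= p -> x `^ r <= 2 `^ p.
    move=> r0 rp; apply: (@le_trans _ _ (x `^ p)); first by rewrite ler_powR.
    by rewrite ge0_ler_powR ?nnegrE ?(ltW p0)//; lra.
  have -> : d = 1 * d by rewrite mul1r.
  apply: ler_pM => //; [exact: ltW|exact: A|].
  have -> : ew p q t x = expR (t.1 * x `^ q + t.2 * x `^ p).
    by rewrite /ew ger0_norm//; lra.
  rewrite ler_expR.
  have s1 : - `|t.1| <= t.1 by rewrite lerNl -normrN ler_norm.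
  have s2 : - `|t.2| <= t.2 by rewrite lerNl -normrN ler_norm.
  have n1 : 0 <= `|t.1| by []. 
  have n2 : 0 <= `|t.2| by []. 
  have := B _ (ltW q0) (ltW qp); have := B _ (ltW p0) (lexx p).
  have := A _ (ltW q0); have := A _ (ltW p0).
  have := powR_ge0 (2 : R) p.
  nra.
apply: lt_le_trans.
have -> : Rint (fun x => d * \1_(`[1%R, 2%R]%classic : set R) x) = d * 1.
  rewrite RintZ; last exact: intg_indic.
  by rewrite Rint_indic; [congr (_ * _); lra|lra].
by rewrite mulr1.
Qed.

Lemma mom_scale k c t : 0 <= k -> 0 < c -> admissible t ->
  mom k (c `^ q * t.1, c `^ p * t.2) = c^-1 * c^-1 `^ k * mom k t.
Proof.
move=> k0 c0 ad.
have ad' := admissible_scale p q c0 ad.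
have mE : measurable_fun [set: R] (fun x => (`|x| `^ k * ew p q t x)%:E).
  by apply/measurable_EFinP; apply: measurable_funM; [exact: measurable_normrX|exact: measurable_ew].
have f0 (x : R) : (0 <= (`|x| `^ k * ew p q t x)%:E)%E.
  by rewrite lee_fin mulr_ge0 ?powR_ge0 ?ew_ge0.
have mEc : measurable_fun [set: R] (fun x => (`|c * x| `^ k * ew p q t (c * x))%:E).
  by apply: (measurableT_comp mE); exact: measurable_funM.
have pw (x : R) : `|x| `^ k * ew p q (c `^ q * t.1, c `^ p * t.2) x =
    c^-1 `^ k * (`|c * x| `^ k * ew p q t (c * x)).
  have ck : c^-1 `^ k * c `^ k = 1.
    by rewrite (powRVl _ (ltW c0)) mulVf// gt_eqF// powR_gt0.
  have cx j : `|c * x| `^ j = c `^ j * `|x| `^ j.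
    by rewrite normrM (gtr0_norm c0) powRM// ltW.
  have -> : `|x| `^ k = c^-1 `^ k * `|c * x| `^ k by rewrite cx mulrA ck mul1r.
  by rewrite -mulrA /ew/= !cx; congr (_ * (_ * expR _)); ring.
apply/EFin_inj; rewrite EFin_mom//.
transitivity (\int[mu]_x ((c^-1 `^ k)%:E * (`|c * x| `^ k * ew p q t (c * x))%:E))%E.
  by apply: eq_integral => x _; rewrite pw EFinM.
rewrite (ge0_integralZl mu measurableT mEc (fun x _ => f0 (c * x))) ?lee_fin ?powR_ge0//.
by rewrite (integral_scale c0 mE f0) -EFin_mom// -!EFinM mulrCA mulrA.
Qed.

End Moments.

(** * Concentration of the tilted densities *)

Section Laplace.
Context {R : realType}.
Notation mu := (@lebesgue_measure R).
Variables p q : R.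
Hypotheses (q1 : 1 <= q) (qp : q < p).

Let q0 : 0 < q := lt_le_trans ltr01 q1.
Let p0 : 0 < p := lt_trans q0 qp.
Notation r := (p / q).

Let r1 : 1 < r. Proof. by rewrite ltr_pdivlMr ?mul1r. Qed.

Let powRpq (s : R) : 0 <= s -> s `^ p = (s `^ q) `^ r.
Proof. by move=> s0; rewrite -powRrM mulrCA mulfV ?mulr1// gt_eqF. Qed.

(* exp (- T phi) is proportional to the density with parameter (T r, - T), and
   [phi] is minimal exactly at |s| = 1. *)
Definition phi (s : R) : R := `|s| `^ p - r * `|s| `^ q + r - 1.

Lemma phi_gt0 s : `|s| != 1 -> 0 < phi s.
Proof.
move=> s1; rewrite /phi powRpq//.
have : `|s| `^ q != 1.
  apply: contra_neq s1 => h.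
  have -> : `|s| = (`|s| `^ q) `^ q^-1 by rewrite -powRrM mulfV ?powRr1// gt_eqF.
  by rewrite h powR1.
move/(bernoulli_powR r1 (powR_ge0 _ _)); lra.
Qed.

Lemma phi1 s : `|s| = 1 -> phi s = 0.
Proof. by move=> s1; rewrite /phi s1 !powR1; lra. Qed.

Lemma phi_ge0 s : 0 <= phi s.
Proof. by have [/phi1 ->//|/phi_gt0/ltW] := eqVneq `|s| 1. Qed.

Lemma expR_phi (T e s : R) :
  expR (- T * (phi s - e)) = expR (T * (e - (r - 1))) * ew p q (T * r, - T) s.
Proof. by rewrite /ew -expRD; congr expR; rewrite /phi/=; ring. Qed.

Lemma intg_lin (t : R * R) (a0 a1 a2 : R) : admissible t ->
  intg (fun s => (a0 + a1 * `|s| `^ q + a2 * `|s| `^ p) * ew p q t s).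
Proof.
move=> ad.
have := intgD (intgD (intgZ a0 (intg_mom q1 qp (lexx 0) ad))
  (intgZ a1 (intg_mom q1 qp (ltW q0) ad))) (intgZ a2 (intg_mom q1 qp (ltW p0) ad)).
by congr intg; apply/funext => s; rewrite powRr0; ring.
Qed.

Lemma Rint_lin (t : R * R) (a0 a1 a2 : R) : admissible t ->
  Rint (fun s => (a0 + a1 * `|s| `^ q + a2 * `|s| `^ p) * ew p q t s) =
  a0 * mom p q 0 t + a1 * mom p q q t + a2 * mom p q p t.
Proof.
move=> ad; have i0 := intg_mom q1 qp (lexx 0) ad.
have i1 := intg_mom q1 qp (ltW q0) ad; have i2 := intg_mom q1 qp (ltW p0) ad.
rewrite /mom -!RintZ// -!RintD; try exact: intgZ.
  by apply: eq_Rint => s; rewrite powRr0; ring.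
by apply: intgD; exact: intgZ.
Qed.

(* As [T] grows, the tilted measures concentrate where [phi] vanishes. *)
Lemma tilt_concentrates (e : R) : 0 < e -> exists2 T, 0 < T &
  let t := (T * r, - T) in
  mom p q p t - r * mom p q q t + (r - 1) * mom p q 0 t < e * mom p q 0 t.
Proof.
move=> e0.
have alg (a0 a1 a2 : R) : (r - 1 - e) * a0 + - r * a1 + 1 * a2 < 0 ->
    a2 - r * a1 + (r - 1) * a0 < e * a0 by move=> h; lra.
(* On [1, b] one has |s|^p <= 1 + e / 2 and |s|^q >= 1, hence phi <= e / 2. *)
pose b := (1 + e / 2) `^ p^-1.
have b1 : 1 < b.
  have -> : 1 = 1 `^ p^-1 :> R by rewrite powR1.
  by rewrite gt0_ltr_powR ?invr_gt0 ?nnegrE//; lra.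
pose m0 := mom p q 0 (r, - 1).
have ad1 : admissible (r, - 1 : R) by left => /=; lra.
have m00 : 0 < m0 by exact: mom_gt0.
pose K := expR (e - (r - 1)).
have K0 : 0 < K by exact: expR_gt0.
(* Chosen so that the bound [2 / T * K * m0] for the positive part of the integral of [ineq] is less
   than the gain [e / 2 * (b - 1)] on [1, b]; the summand 2 ensures T / 2 >= 1. *)
pose T := 2 + 4 * K * m0 / (e * (b - 1)).
have T2 : 2 < T.
  by rewrite ltrDl divr_gt0 ?mulr_gt0//; lra.
have T0 : 0 < T by lra.
exists T => // t.
have adt : admissible t by left; rewrite /t /=; lra.
(* Integrating this bounds the tilted mean of phi by e. On [1, b] the left side is at most - e / 2.
   Where y = phi - e is positive, T y / 2 <= exp (T y / 2) leaves the factor exp (- T y / 2) <= exp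
   (- y), whose integral does not depend on T. *)
have ineq s : (phi s - e) * expR (- T * (phi s - e)) <=
    2 / T * expR (- (phi s - e)) + - (e / 2) * \1_(`[1, b]%classic : set R) s.
  have E0 : 0 < expR (- T * (phi s - e)) by exact: expR_gt0.
  have E1 : 0 <= 2 / T * expR (- (phi s - e)) by rewrite mulr_ge0 ?expR_ge0 ?divr_ge0//; lra.
  rewrite indicE; have [|_] := boolP (s \in _).
    rewrite inE/= in_itv/= => /andP[s1 sb].
    have s0 : 0 <= s by lra.
    have hs : phi s <= e / 2.
      have hp : s `^ p <= 1 + e / 2 by rewrite powR_le_root//; lra.
      have hq : 1 <= s `^ q by rewrite -(powRr0 s) ler_powR// ltW.
      rewrite /phi ger0_norm//; have := r1; nra.
    have E2 : 1 <= expR (- T * (phi s - e)).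
      by rewrite -expR0 ler_expR; nra.
    rewrite mulr1; nra.
  rewrite mulr0 addr0; have [h|h] := leP (phi s) e; first by apply: le_trans E1; nra.
  have y0 : 0 < phi s - e by lra.
  have h1 : T * (phi s - e) / 2 <= expR (T * (phi s - e) / 2).
    by apply: le_trans (expR_ge1Dx _); rewrite lerDr.
  have h2 : expR (T * (phi s - e) / 2) * expR (- T * (phi s - e)) <= expR (- (phi s - e)).
    rewrite -expRD ler_expR; nra.
  have -> : phi s - e = 2 / T * (T * (phi s - e) / 2).
    by field; rewrite gt_eqF.
  rewrite -[leLHS]mulrA ler_wpM2l//; first by rewrite divr_ge0//; lra.
  have -> : 2 / T * (T * (phi s - e) / 2) = phi s - e by field; rewrite gt_eqF.
  by apply: le_trans h2; rewrite ler_wpM2r ?expR_ge0.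
pose KT := expR (T * (e - (r - 1))).
have KT0 : 0 < KT by exact: expR_gt0.
have eqL s : (phi s - e) * expR (- T * (phi s - e)) =
    KT * (((r - 1 - e) + (- r) * `|s| `^ q + 1 * `|s| `^ p) * ew p q t s).
  by rewrite expR_phi /phi -/KT /t; ring.
have eqR s : 2 / T * expR (- (phi s - e)) = 2 / T * K * (`|s| `^ 0 * ew p q (r, - 1) s).
  have := expR_phi 1 e s; rewrite mulN1r => ->.
  by rewrite !mul1r -/K powRr0; ring.
have iL := intg_lin (r - 1 - e) (- r) 1 adt.
have iR := intg_mom q1 qp (lexx 0) ad1.
have : Rint (fun s => KT * (((r - 1 - e) + (- r) * `|s| `^ q + 1 * `|s| `^ p) * ew p q t s)) <=
   Rint (fun s => 2 / T * K * (`|s| `^ 0 * ew p q (r, - 1) s) + - (e / 2) * \1_(`[1, b]%classic : set R) s).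
  apply: le_Rint; first exact: intgZ.
    by apply: intgD; apply: intgZ => //; exact: intg_indic.
  by move=> s; rewrite -eqL -eqR.
rewrite RintZ// Rint_lin// RintD; first last.
- by apply: intgZ; exact: intg_indic.
- exact: intgZ.
rewrite !RintZ//; last exact: intg_indic.
rewrite Rint_indic ?(ltW b1)// -/(mom p q 0 (r, -1)) -/m0 => h.
have h3 : 2 / T * K * m0 < e / 2 * (b - 1).
  have X0 : 0 < e * (b - 1) by rewrite mulr_gt0// subr_gt0.
  have hT : (T - 2) * (e * (b - 1)) = 4 * K * m0.
    by rewrite /T addrAC subrr add0r divfK// gt_eqF.
  have -> : 2 / T * K * m0 = (2 * K * m0) / T by field; rewrite gt_eqF.
  rewrite ltr_pdivrMr//; move: hT X0; clear; nra.
have : KT * ((r - 1 - e) * mom p q 0 t + - r * mom p q q t + 1 * mom p q p t) < 0.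
  by apply: (le_lt_trans h); rewrite mulNr subr_lt0.
by rewrite pmulr_rlt0// => /alg.
Qed.

(** Divided by exp (T (r - 1)), the partition function becomes the integral of exp (- T phi), which
    tends to 0 by dominated convergence because phi > 0 almost everywhere. This is the source of the
    infinite rate on [1, oo[. *)
Lemma Zint_vanish (e : R) : 0 < e -> exists2 T, 0 < T &
  (Zint p q (T * r, - T)%R < (e * expR (T * (r - 1)))%:E)%E.
Proof.
move=> e0.
pose f (n : nat) (s : R) : \bar R := (expR (- (n.+1)%:R * phi s))%:E.
have mphi : measurable_fun [set: R] phi.
  apply: measurable_funB => //; apply: measurable_funD => //.
  apply: measurable_funB; first exact: measurable_normrX.
  by apply: measurable_funM => //; exact: measurable_normrX.
have mf n : measurable_fun [set: R] (f n).
  apply/measurable_EFinP; apply: (measurableT_comp (@measurable_expR R)).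
  exact: measurable_funM.
pose S : set R := [set 1] `|` [set -1].
pose g (s : R) : \bar R := (\1_S s)%:E.
have ad1 : admissible (r, - 1 : R) by left => /=; lra.
have fg s : f n s @[n --> \oo] --> g s.
  have Ef n : expR (- n.+1%:R * phi s) = expR (- phi s) ^+ n.+1.
    by rewrite -expRM_natl mulrN mulNr.
  suff : (fun n => expR (- phi s) ^+ n.+1) n @[n --> \oo] --> (\1_S s : R).
    move=> H; apply: cvg_EFin; first exact: nearW.
    by apply: cvg_trans H; apply: near_eq_cvg; apply: nearW => n; rewrite /= -Ef.
  rewrite indicE; have [sS|sS] := boolP (s \in S).
    have -> : phi s = 0.
      apply: phi1; move: sS; rewrite inE => -[|] /= ->; by rewrite ?normrN normr1.
    rewrite oppr0 expR0; under eq_fun do rewrite expr1n; exact: cvg_cst.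
  have h : 0 < phi s.
    apply: phi_gt0; apply: contra sS => /eqP h; rewrite inE /S/=.
    by have [h'|h'] := leP 0 s; [left|right]; move: h; [rewrite ger0_norm|rewrite ltr0_norm//]; lra.
  have : (fun n => expR (- phi s) ^+ n) n @[n --> \oo] --> (0 : R).
    by apply: cvg_expr; rewrite ger0_norm ?expR_ge0// -expR0 ltr_expR oppr_lt0.
  by move=> h'; have := h'; rewrite -cvg_shiftS.
have i1 : intg (fun s => expR (- 1 * phi s)).
  have := intgZ (expR (0 - (r - 1))) (integrable_ew q1 qp ad1).
  congr intg; apply/funext => s.
  by rewrite -[phi s]subr0 expR_phi !mul1r.
have := @dominated_cvg _ _ _ mu setT measurableT f g (EFin \o (fun s => expR (- 1 * phi s))) mf.
move=> /(_ (fun s _ => fg s) (fun _ _ => isT) i1).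
have H n s : setT s -> (`|f n s| <= (EFin \o (fun s => expR (- 1 * phi s))) s)%E.
  move=> _ /=; rewrite lee_fin ger0_norm ?expR_ge0// ler_expR !mulNr lerN2.
  by rewrite ler_wpM2r ?phi_ge0// ler1n.
move=> /(_ H).
have -> : (\int[mu]_x g x = 0)%E.
  rewrite /g integral_indic//=; last by apply: measurableU; exact: measurable_set1.
  have : (mu S <= mu [set (1 : R)%R] + mu [set (- 1 : R)%R])%E by exact: measureU2.
  rewrite !lebesgue_measure_set1 adde0 setIT => hS.
  by apply/eqP; rewrite eq_le; apply/andP; split => //; exact: measure_ge0.
move=> /fine_cvgP[fin] /cvgrPdist_lt /(_ _ e0) near2.
near \oo => n.
have h1 : (\int[mu]_x f n x)%E \is a fin_num by near: n; exact: fin.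
have h2 : `|0 - fine (\int[mu]_x f n x)%E| < e by near: n; exact: near2.
exists n.+1%:R; first by rewrite ltr0n.
have E : (\int[mu]_x f n x = (expR (n.+1%:R * (0 - (r - 1))))%:E * Zint p q (n.+1%:R * r, - n.+1%:R)%R)%E.
  rewrite -ge0_integralZl//.
  - apply: eq_integral => s _; rewrite -EFinM -expR_phi.
    by rewrite /f subr0.
  - by apply/measurable_EFinP; exact: measurable_ew.
  - by move=> s _; rewrite lee_fin expR_ge0.
have h3 : (\int[mu]_x f n x < e%:E)%E.
  rewrite -(fineK h1) lte_fin; apply: le_lt_trans h2.
  by rewrite sub0r normrN ler_norm.
move: h3; rewrite E.
set Z := Zint _ _ _; have : Z \is a fin_num.
  by apply: Zint_fin => //; left => /=; rewrite oppr_lt0 ltr0n.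
case: Z => // z _; rewrite -EFinM !lte_fin => h3.
have -> : z = expR (n.+1%:R * (0 - (r - 1))) * z * expR (n.+1%:R * (r - 1)).
  by rewrite mulrAC -expRD sub0r mulrN addNr expR0 mul1r.
by rewrite ltr_pM2r ?expR_gt0.
Unshelve. all: end_near. Qed.

End Laplace.

(** * Existence of the tilt *)

Section Tilt.
Local Opaque mom.
Context {R : realType}.
Notation mu := (@lebesgue_measure R).
Variables p q : R.
Hypotheses (q1 : 1 <= q) (qp : q < p).

Let q0 : 0 < q := lt_le_trans ltr01 q1.
Let p0 : 0 < p := lt_trans q0 qp.
Notation r := (p / q).

Let r1 : 1 < r. Proof. by rewrite ltr_pdivlMr ?mul1r. Qed.

(** The square keeps the second parameter nonpositive for negative [th] too, so the path is
    admissible on an open interval around [0, 1]. The exponent is affine in th^2, which stays in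
    [0, 4]; hence the weights at the values 0 and 4 of th^2 together dominate. *)
Lemma tilt_path_continuous (T k : R) : 0 < T -> 0 <= k ->
  {in `]-1, 2[%classic, continuous
     (fun th : R => mom p q k (th ^+ 2 * (1 + T * r) - 1, - (th ^+ 2 * T)))}.
Proof.
move=> T0 k0.
pose tt (c : R) : R * R := (c * (1 + T * r) - 1, - (c * T)).
have ad c : 0 <= c -> admissible (tt c).
  rewrite le_eqVlt => /predU1P[<-|c0].
    by right; rewrite /tt/= !mul0r oppr0 sub0r; split => //; lra.
  by left; rewrite /tt/= oppr_lt0 mulr_gt0.
pose b (y : R) : R := (1 + T * r) * `|y| `^ q - T * `|y| `^ p.
have ewE c y : ew p q (tt c) y = expR (- `|y| `^ q + c * b y).
  by rewrite /ew /tt /b/=; congr expR; ring.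
pose f (th y : R) : R := `|y| `^ k * ew p q (tt (th ^+ 2)) y.
pose g (y : R) : R := `|y| `^ k * ew p q (tt 0) y + `|y| `^ k * ew p q (tt 4) y.
apply: (@continuity_under_integral R _ _ mu f setT measurableT (-1) 2 _ _ g).
- by move=> th _; apply: intg_mom => //; apply: ad; exact: sqr_ge0.
- apply: aeW => y _ th _.
  rewrite /f; under eq_fun do rewrite ewE.
  apply: (@continuousM _ R^o (fun=> `|y| `^ k) (fun th : R => expR (- `|y| `^ q + th ^+ 2 * b y))).
    exact: cst_continuous.
  apply: (@continuous_comp _ _ _ (fun th : R => - `|y| `^ q + th ^+ 2 * b y) expR); last exact: continuous_expR.
  apply: (@continuousD _ R^o); first exact: cst_continuous.
  apply: (@continuousM _ R^o (fun th : R => th ^+ 2) (fun=> b y)); last exact: cst_continuous.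
  exact: exprn_continuous.
- by apply: intgD; apply: intg_mom => //; apply: ad.
- move=> th; rewrite /= in_itv/= => /andP[h1 h2].
  apply: aeW => y _; rewrite ger0_norm ?mulr_ge0 ?powR_ge0 ?ew_ge0//.
  rewrite /f /g -mulrDr ler_wpM2l ?powR_ge0// !ewE mul0r addr0.
  have [b0|b0] := leP 0 (b y).
    apply: (@le_trans _ _ (expR (- `|y| `^ q + 4 * b y))); last by rewrite lerDr expR_ge0.
    by rewrite ler_expR lerD2l ler_wpM2r//; nra.
  apply: (@le_trans _ _ (expR (- `|y| `^ q))); last by rewrite lerDl expR_ge0.
  by rewrite ler_expR gerDl mulr_ge0_le0 ?sqr_ge0// ltW.
Qed.

(** A Young-type inequality: r x P^(q/p) <= P + (r - 1) k with k = x^(p/(p-q)). Together with Q <= x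
    P^(q/p) it would contradict the hypothesis. *)
Lemma tilt_ratio_bound (x P Q : R) : 0 < x < 1 -> 0 < P -> 0 < Q ->
  P - r * Q + (r - 1) < (r - 1) * (1 - x `^ (p / (p - q))) ->
  ln x < ln Q - q / p * ln P.
Proof.
move=> /andP[x0 x1] P0 Q0 H.
have pq0 : 0 < p - q by rewrite subr_gt0.
have qp0 : 0 < q / p by exact: divr_gt0.
suff : x * P `^ (q / p) < Q.
  move=> h; rewrite -ln_powR ltrBrDr -lnM ?posrE ?powR_gt0//.
  by rewrite ltr_ln ?posrE// mulr_gt0// powR_gt0.
rewrite ltNge; apply/negP => QP.
(* [k] is the solution of x k^(q/p) = k, which gives x P^(q/p) = k v; Bernoulli is then applied to
   v. *)
set k := x `^ (p / (p - q)) in H.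
have k0 : 0 < k by exact: powR_gt0.
pose v := (P / k) `^ (q / p).
have vr : v `^ r = P / k.
  have e1 : q / p * r = 1 by field; rewrite !gt_eqF.
  by rewrite /v -powRrM e1 (powRr1 (divr_ge0 (ltW P0) (ltW k0))).
have hv : r * v <= P / k + r - 1.
  rewrite -vr; have [->|v1] := eqVneq v 1; first by rewrite powR1; lra.
  by apply/ltW/bernoulli_powR => //; exact: powR_ge0.
have xk : x * P `^ (q / p) = k * v.
  have -> : P `^ (q / p) = k `^ (q / p) * v.
    by rewrite /v -(powRM _ (ltW k0) (divr_ge0 (ltW P0) (ltW k0))) mulrCA mulfV ?mulr1// gt_eqF.
  rewrite mulrA; congr (_ * v).
  have -> : x * k `^ (q / p) = x `^ 1 * x `^ (p / (p - q) * (q / p)).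
    by rewrite powRr1 ?(ltW x0)// /k -powRrM.
  rewrite -powRD; last by rewrite (gt_eqF x0) implybT.
  by rewrite /k; congr (_ `^ _); field; rewrite !gt_eqF.
have h1 : r * Q <= r * (k * v) by rewrite -xk ler_pM2l// (lt_trans ltr01 r1).
have h2 : k * (r * v) <= k * (P / k + r - 1) by rewrite ler_pM2l.
have h3 : k * (P / k + r - 1) = P + k * r - k by field; rewrite !gt_eqF.
move: H h1 h2; rewrite h3; clear; nra.
Qed.

(* The logarithm of E|s|^q / (E|s|^p)^(q/p), which is invariant under scaling,
   comes arbitrarily close to 0. *)
Lemma tilt_ratio_large (x : R) : 0 < x < 1 -> exists2 T, 0 < T &
  let t := (T * r, - T) in
  ln x < ln (mom p q q t / mom p q 0 t) - q / p * ln (mom p q p t / mom p q 0 t).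
Proof.
move=> x01; have /andP[x0 x1] := x01.
have k1 : x `^ (p / (p - q)) < 1.
  have -> : 1 = 1 `^ (p / (p - q)) :> R by rewrite powR1.
  by rewrite gt0_ltr_powR ?divr_gt0 ?subr_gt0 ?nnegrE// ltW.
have e0 : 0 < (r - 1) * (1 - x `^ (p / (p - q))) by rewrite mulr_gt0// subr_gt0.
have [T T0 H] := tilt_concentrates q1 qp e0.
exists T => // t; move: H; rewrite -/t /=.
have adt : admissible t by left; rewrite /t /= oppr_lt0.
move: (mom_gt0 q1 qp (lexx 0) adt) (mom_gt0 q1 qp (ltW q0) adt) (mom_gt0 q1 qp (ltW p0) adt).
move: (mom p q 0 t) (mom p q q t) (mom p q p t) => M0 Mq Mp m0 mq mp H.
apply: tilt_ratio_bound => //; [exact: divr_gt0|exact: divr_gt0|].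
rewrite -(ltr_pM2r m0); apply: le_lt_trans H.
by rewrite le_eqVlt; apply/orP; left; apply/eqP; field; rewrite !gt_eqF.
Qed.

Lemma IVT01 (f : R -> R) (v : R) : {within `[0, 1], continuous f} ->
  f 0 < v -> v < f 1 -> exists c, f c = v.
Proof.
move=> cf f0 f1; have [|c _ hc] := IVT (v := v) ler01 cf; last by exists c.
by rewrite ge_min le_max (ltW f0) (ltW f1) orbT.
Qed.

(** Scaling by this [c] turns the mean Q of |s|^q into x. The new mean of |s|^p is then at most 1
    exactly when the invariant ln Q - (q/p) ln P is at least ln x, and equals 1 in case of
    equality. *)
Lemma scale_ratio (x P Q : R) (c := (Q / x) `^ q^-1) :
  0 < x -> 0 < P -> 0 < Q ->
  [/\ 0 < c, c `^ q = Q / x &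
      ln (c^-1 `^ p * P) = p / q * (ln x - (ln Q - q / p * ln P))].
Proof.
move=> x0 P0 Q0; have Qx0 : 0 < Q / x := divr_gt0 Q0 x0.
have c0 : 0 < c by exact: powR_gt0.
split=> //.
  by rewrite /c -powRrM mulVf ?gt_eqF// (powRr1 (ltW Qx0)).
rewrite lnM ?posrE ?powR_gt0 ?invr_gt0// ln_powR lnV ?posrE//.
rewrite /c ln_powR ln_div ?posrE//.
by field; rewrite !gt_eqF.
Qed.

(* The parameter comes from the intermediate value theorem along a segment
   joining [(-1, 0)] to a strongly tilted parameter, and then from scaling. *)
Lemma tilt_exists (x : R) : 0 < x < 1 -> exists (t : R * R) (P : R),
  [/\ admissible t, mom p q q t = x * mom p q 0 t,
      mom p q p t = P * mom p q 0 t, 0 < P <= 1 & t.2 * P = t.2].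
Proof.
move=> x01; have /andP[x0 x1] := x01.
have qp0 : 0 < q / p by exact: divr_gt0.
pose h t := ln (mom p q q t / mom p q 0 t) - q / p * ln (mom p q p t / mom p q 0 t).
(* [h] is the scale-invariant log-ratio, so it remains to reach ln x with it, or to exceed ln x at a
   parameter with t.2 = 0; scaling preserves t.2 = 0. *)
suff [t [ad ht t2]] : exists t, [/\ admissible t, ln x <= h t & t.2 = 0 \/ h t = ln x].
  have sc c k : 0 < c -> 0 <= k -> mom p q k (c `^ q * t.1, c `^ p * t.2) =
      c^-1 * c^-1 `^ k * mom p q k t.
    by move=> c0 k0; exact: mom_scale.
  move: ht t2 (mom_gt0 q1 qp (lexx 0) ad) (mom_gt0 q1 qp (ltW q0) ad) (mom_gt0 q1 qp (ltW p0) ad).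
  move: sc (sc^~ q) (sc^~ p) (sc^~ 0) => _ scq scp sc0; rewrite /h {h}.
  move: (mom p q q t) (mom p q p t) (mom p q 0 t) scq scp sc0.
  move=> Mq Mp M0 scq scp sc0 ht t2 m0 mq mp.
  have P0 : 0 < Mp / M0 := divr_gt0 mp m0.
  have Q0 : 0 < Mq / M0 := divr_gt0 mq m0.
  have := scale_ratio x0 P0 Q0; set c := (_ `^ q^-1) => -[c0 cq lncp].
  have ad' := admissible_scale p q c0 ad.
  have hP0 : 0 < c^-1 `^ p * (Mp / M0) by rewrite mulr_gt0// powR_gt0// invr_gt0.
  exists (c `^ q * t.1, c `^ p * t.2), (c^-1 `^ p * (Mp / M0)); split => //.
  - rewrite scq ?sc0 ?(ltW q0)// powRr0 (powRVl _ (ltW c0)) cq.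
    by clear -c0 mq m0 x0; field; rewrite !gt_eqF.
  - rewrite scp ?sc0 ?(ltW p0)// powRr0.
    by clear -c0 mp m0; field; rewrite !gt_eqF.
  - rewrite hP0/= -ler_ln ?posrE// ln1 lncp.
    by rewrite pmulr_rle0 ?divr_gt0// subr_le0.
  - case: t2 => [->|ht']; first by rewrite /= !mulr0 mul0r.
    suff -> : c^-1 `^ p * (Mp / M0) = 1 by rewrite mulr1.
    by apply: ln_inj; rewrite ?posrE// ln1 lncp ht' subrr mulr0.
have adm1 : admissible (- 1, 0 : R) by right; split => //=; lra.
have le_or_lt (a b : R) : a <= b \/ b < a by case: (leP a b); [left|right].
(* Without any p-tilt the ratio already suffices: after scaling, the constraint on the p-th power
   mean holds with P <= 1. *)
have [h0|h0] := le_or_lt (ln x) (h (- 1, 0)).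
  by exists (- 1, 0); split => //; left.
have [T T0 hT] := tilt_ratio_large x01.
pose tt (th : R) : R * R := (th ^+ 2 * (1 + T * r) - 1, - (th ^+ 2 * T)).
have adtt th : admissible (tt th).
  have [->|th0] := eqVneq th 0.
    by right; rewrite /tt/= expr0n/= !mul0r oppr0 sub0r; split => //; lra.
  by left; rewrite /tt/= oppr_lt0 mulr_gt0// exprn_even_gt0.
have tt0 : tt 0 = (- 1, 0) by rewrite /tt expr0n/= !mul0r oppr0 sub0r.
have tt1 : tt 1 = (T * r, - T) by rewrite /tt expr1n !mul1r addrAC subrr add0r.
have cont : {within `[0, 1], continuous (h \o tt)}.
  apply: continuous_in_subspaceT => th; rewrite inE/= in_itv/= => /andP[th0 th1].
  have th12 : th \in `]-1, 2[%classic by rewrite inE/= in_itv/=; apply/andP; split; lra.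
  have cm k : 0 <= k -> {for th, continuous (fun th => mom p q k (tt th))}.
    by move=> k0; exact: (tilt_path_continuous T0 k0 th12).
  have cl k : 0 <= k -> {for th, continuous (fun th => ln (mom p q k (tt th) / mom p q 0 (tt th)))}.
    move=> k0; apply: (@continuous_comp _ _ _ (fun th => mom p q k (tt th) / mom p q 0 (tt th)) (@ln R)).
      apply: continuousM; first exact: cm.
      apply: continuousV; first by rewrite gt_eqF// mom_gt0.
      exact: cm.
    by apply: continuous_ln; rewrite divr_gt0// mom_gt0.
  have H1 := cl q (ltW q0); have H2 := cl p (ltW p0).
  have H3 : {for th, continuous (fun th => q / p * ln (mom p q p (tt th) / mom p q 0 (tt th)))}.
    by apply: (@continuousM _ R^o (fun=> q / p) _ th) => //; exact: cst_continuous.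
  exact: (@continuousB _ R^o _ _ _ th H1 H3).
have E0 : h (tt 0) < ln x by rewrite tt0.
have E1 : ln x < h (tt 1) by rewrite tt1; exact: hT.
have [c hc] := IVT01 cont E0 E1.
by exists (tt c); split; [exact: adtt|rewrite (hc : h (tt c) = ln x)|right].
Qed.

End Tilt.

(** * Chernoff and Chebyshev bounds *)

Section Tilting.
Context {R : realType}.
Notation mu := (@lebesgue_measure R).
Variables p q : R.
Hypotheses (q1 : 1 <= q) (qp : q < p).

Let q0 : 0 < q := lt_le_trans ltr01 q1.
Let p0 : 0 < p := lt_trans q0 qp.

Definition tilt (t v : R * R) : R := expR (t.1 * v.1 + t.2 * v.2).

Lemma tilt_gt0 t v : 0 < tilt t v. Proof. exact: expR_gt0. Qed.

Lemma measurable_tilt t : measurable_fun [set: R * R] (tilt t).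
Proof.
apply: (measurableT_comp (@measurable_expR R)).
by apply: measurable_funD; apply: measurable_funM.
Qed.

Lemma nneg_measurable_tilt t : nneg_measurable (fun v => (tilt t v)%:E).
Proof.
by split; [apply/measurable_EFinP; exact: measurable_tilt|move=> v; rewrite lee_fin ltW// tilt_gt0].
Qed.

Lemma tilt_step t v (x : R) :
  tilt t (v.1 + `|x| `^ q, v.2 + `|x| `^ p) = tilt t v * ew p q t x.
Proof. by rewrite /tilt /ew -expRD; congr expR => /=; ring. Qed.

(** The exponential of a sum factorises, so each coordinate contributes one factor z. *)
Lemma stat_int_tilt n t z : Zint p q t = z%:E ->
  stat_int p q n (fun v => (tilt t v)%:E) = (z ^+ n)%:E.
Proof.
move=> zE; rewrite /stat_int.
suff H v : iter n (stat_step p q) (fun v => (tilt t v)%:E) v = (z ^+ n * tilt t v)%:E.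
  by rewrite H /tilt/= !mulr0 addr0 expR0 mulr1.
have z0 : 0 <= z by rewrite -lee_fin -zE ltW// Zint_gt0.
elim: n v => [|n IH] v /=; first by rewrite mul1r.
rewrite /stat_step; under eq_integral do rewrite IH tilt_step mulrA EFinM.
rewrite ge0_integralZl//.
- by rewrite -/(Zint p q t) zE -EFinM exprSr; congr (_%:E); ring.
- by apply/measurable_EFinP; exact: measurable_ew.
- by move=> x _; rewrite lee_fin ew_ge0.
- by rewrite lee_fin mulr_ge0 ?exprn_ge0// ltW// tilt_gt0.
Qed.

Lemma chernoff_stat_int n t z (S : set (R * R)) (a : R) :
    measurable S -> Zint p q t = z%:E ->
    (forall v, S v -> 0 <= v.1 -> 0 <= v.2 -> a <= t.1 * v.1 + t.2 * v.2) ->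
  (stat_int p q n (fun v => (\1_S v)%:E) <= (expR (- a) * z ^+ n)%:E)%E.
Proof.
move=> mS zE H; rewrite EFinM -(stat_int_tilt n zE) -stat_intZ ?expR_ge0//; last exact: nneg_measurable_tilt.
apply: le_stat_int; [exact: nneg_measurable_indic|apply: nneg_measurableZ; [exact: expR_ge0|exact: nneg_measurable_tilt]|].
move=> v v1 v2; rewrite -EFinM lee_fin indicE; have [|_] := boolP (v \in S).
  rewrite inE => Sv; rewrite -expRD -expR0 ler_expR addrC subr_ge0; exact: H.
by rewrite mulr_ge0 ?expR_ge0.
Qed.

Lemma EFin_Rint (f : R -> R) : intg f -> (\int[mu]_x (f x)%:E)%E = (Rint f)%:E.
Proof. by move=> fi; rewrite /Rint /Rintegral fineK//; exact: (integrable_fin_num _ fi). Qed.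

Definition sqdist (v w : R * R) : R := (v.1 - w.1) ^+ 2 + (v.2 - w.2) ^+ 2.

Lemma sqdist_ge0 v w : 0 <= sqdist v w.
Proof. by rewrite addr_ge0// sqr_ge0. Qed.

Lemma measurable_sqdist w : measurable_fun [set: R * R] (fun v => sqdist v w).
Proof.
by apply: measurable_funD; apply: measurable_funX; apply: measurable_funB.
Qed.

Definition window (n : nat) (Q P d : R) : set (R * R) :=
  [set v | `|v.1 - n%:R * Q| < n%:R * d /\ `|v.2 - n%:R * P| < n%:R * d].

Lemma measurable_window n Q P d : measurable (window n Q P d).
Proof.
have m1 (b : R) (f : R * R -> R) : measurable_fun setT f ->
    measurable [set v : R * R | `|f v - b| < n%:R * d].
  move=> mf; rewrite -[X in measurable X]setTI.
  apply: (@measurable_fun_ltr _ _ _ _ (fun v => `|f v - b|) (fun=> n%:R * d)) => //.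
  by apply: (measurableT_comp (@normr_measurable R setT)); exact: measurable_funB.
by apply: measurableI; [exact: (m1 _ fst measurable_fst)|exact: (m1 _ snd measurable_snd)].
Qed.

Section SecondMoment.
Variables (t : R * R) (z Q P : R).
Hypotheses (ad : admissible t) (zE : mom p q 0 t = z)
  (QE : mom p q q t = Q * z) (PE : mom p q p t = P * z).

Let z0 : 0 < z. Proof. by rewrite -zE; exact: mom_gt0. Qed.

Let s2 := (mom p q (q + q) t + mom p q (p + p) t) / z - Q ^+ 2 - P ^+ 2.

(* One step translates the reference point by the mean [(Q, P)] and adds the
   variance [s2]. *)
Lemma stat_step_sqdist (c0 c1 : R) (w v : R * R) :
  stat_step p q (fun v => (tilt t v * (c0 * sqdist v w + c1))%:E) v =
  (tilt t v * z * (c0 * (sqdist v (w.1 - Q, w.2 - P) + s2) + c1))%:E.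
Proof.
have i k : 0 <= k -> intg (fun x => `|x| `^ k * ew p q t x).
  by move=> k0; exact: (intg_mom q1 qp k0 ad).
pose e := tilt t v; pose a := v.1 - w.1; pose b := v.2 - w.2.
pose F := fun x : R => e * (c0 * (a ^+ 2 + b ^+ 2) + c1) * (`|x| `^ 0 * ew p q t x) +
   (e * (2 * c0 * a) * (`|x| `^ q * ew p q t x) +
   (e * (2 * c0 * b) * (`|x| `^ p * ew p q t x) +
   (e * c0 * (`|x| `^ (q + q) * ew p q t x) + e * c0 * (`|x| `^ (p + p) * ew p q t x)))).
have i0 := i _ (lexx 0); have iq := i _ (ltW q0); have ip := i _ (ltW p0).
have iqq := i _ (addr_ge0 (ltW q0) (ltW q0)); have ipp := i _ (addr_ge0 (ltW p0) (ltW p0)).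
have j4 := intgD (intgZ (e * c0) iqq) (intgZ (e * c0) ipp).
have j3 := intgD (intgZ (e * (2 * c0 * b)) ip) j4.
have j2 := intgD (intgZ (e * (2 * c0 * a)) iq) j3.
have j1 := intgD (intgZ (e * (c0 * (a ^+ 2 + b ^+ 2) + c1)) i0) j2.
transitivity (\int[mu]_x (F x)%:E)%E.
  apply: eq_integral => x _; congr (_%:E).
  have pw k : 0 < k -> `|x| `^ (k + k) = `|x| `^ k * `|x| `^ k.
    by move=> k0; apply: powRD; rewrite gt_eqF// addr_gt0.
  rewrite tilt_step -/e /F /sqdist/= powRr0 !pw// /a /b; ring.
rewrite (EFin_Rint j1) /F; congr (_%:E).
rewrite RintD//; last exact: intgZ.
rewrite RintD//; last exact: intgZ.
rewrite RintD//; last exact: intgZ.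
rewrite RintD; [|exact: intgZ|exact: intgZ].
rewrite !RintZ// -!/(mom _ _ _ _) zE QE PE /s2.
rewrite /sqdist/=.
have zn := z0; move: (mom p q (q + q) t) (mom p q (p + p) t) => m1 m2.
rewrite /a /b /e; move: (tilt t v) => e'; field; rewrite gt_eqF//.
Qed.

Lemma stat_int_sqdist n :
  stat_int p q n (fun v => (tilt t v * sqdist v (n%:R * Q, n%:R * P))%:E) = (z ^+ n * (n%:R * s2))%:E.
Proof.
rewrite /stat_int.
suff H (w v : R * R) : iter n (stat_step p q) (fun v => (tilt t v * sqdist v w)%:E) v =
    (tilt t v * (z ^+ n * sqdist v (w.1 - n%:R * Q, w.2 - n%:R * P) + z ^+ n * (n%:R * s2)))%:E.
  rewrite H /tilt /sqdist/= !mulr0 addr0 expR0 mul1r; congr (_%:E); ring.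
elim: n v => [|n IH] v /=; first by rewrite !mul0r !subr0 mul1r mulr0 addr0; case: w.
rewrite (_ : iter n _ _ = fun v => (tilt t v * (z ^+ n * sqdist v (w.1 - n%:R * Q, w.2 - n%:R * P) + z ^+ n * (n%:R * s2)))%:E); last exact/funext.
rewrite stat_step_sqdist /=; congr (_%:E).
have -> : (w.1 - n%:R * Q - Q, w.2 - n%:R * P - P) = (w.1 - n.+1%:R * Q, w.2 - n.+1%:R * P).
  by rewrite -natr1 !mulrDl !mul1r !opprD !addrA.
by rewrite exprS -natr1; ring.
Qed.

(** Under the tilted measure, of total mass z^n, the window keeps at least half of the mass;
    dividing by the largest value of the tilt on the window bounds its Lebesgue volume from
    below. *)
Lemma tilt_lower_bound (d : R) : 0 < d -> exists N : nat, forall n, (N <= n)%N ->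
  ((z ^+ n / 2 * expR (- n%:R * (t.1 * Q + t.2 * P + d * (`|t.1| + `|t.2|))))%:E <=
   stat_int p q n (fun v => (\1_(window n Q P d) v)%:E))%E.
Proof.
move=> d0.
(* From here on n d^2 > 2 s2, so Chebyshev leaves at most half of the mass outside the window. *)
exists (Num.truncn (2 * s2 / d ^+ 2)).+1 => n Nn.
have n0 : 0 < n%:R :> R by rewrite ltr0n (leq_trans _ Nn).
have hn : 2 * s2 < n%:R * d ^+ 2.
  rewrite -ltr_pdivrMr ?exprn_gt0//; apply: (@lt_le_trans _ _ (Num.truncn (2 * s2 / d ^+ 2)).+1%:R).
    exact: truncnS_gt.
  by rewrite ler_nat.
have mS := measurable_window n Q P d; set S := window n Q P d in mS *.
set a := t.1 * Q + t.2 * P + d * (`|t.1| + `|t.2|).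
pose k : R := (n%:R * d) ^- 2.
have k0 : 0 < k by rewrite invr_gt0 exprn_gt0// mulr_gt0.
pose w : R * R := (n%:R * Q, n%:R * P).
have etS v : S v -> tilt t v <= expR (n%:R * a).
  move=> [h1 h2]; rewrite ler_expR.
  have A (x y b : R) : `|y - n%:R * b| < n%:R * d -> x * y <= n%:R * (x * b + d * `|x|).
    move=> h; have : x * (y - n%:R * b) <= `|x| * (n%:R * d).
      by apply: (le_trans (ler_norm _)); rewrite normrM ler_wpM2l// ltW.
    lra.
  have := A t.1 _ _ h1; have := A t.2 _ _ h2; rewrite /a; lra.
(* Chebyshev in pointwise form: outside the window the squared distance is at least (n d)^2, the
   inverse of [k]. *)
have ineq v : ((tilt t v)%:E <= (expR (n%:R * a))%:E * (\1_S v)%:E + k%:E * (tilt t v * sqdist v w)%:E)%E.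
  rewrite -!EFinM -EFinD lee_fin indicE; have [vS|vS] := boolP (v \in S).
    rewrite mulr1; move: vS; rewrite inE => /etS h; apply: (le_trans h).
    by rewrite lerDl !mulr_ge0 ?sqdist_ge0// ltW// tilt_gt0.
  rewrite mulr0 add0r mulrCA ler_peMr// ?(ltW (tilt_gt0 _ _))//.
  rewrite /k mulrC ler_pdivlMr ?exprn_gt0 ?mulr_gt0// mul1r /sqdist.
  have B (x : R) : (`|x| < n%:R * d) = false -> (n%:R * d) ^+ 2 <= x ^+ 2.
    move/negbT; rewrite -leNgt => h; rewrite -[leRHS]real_normK ?num_real//.
    by rewrite ler_sqr ?nnegrE// mulr_ge0// ltW.
  move: vS; rewrite notin_setE /S /window /= => /not_andP[]/negP/negbTE/B h.
    by apply: (le_trans h); rewrite lerDl sqr_ge0.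
  by apply: (le_trans h); rewrite lerDr sqr_ge0.
have n1 : nneg_measurable (fun v => (\1_S v)%:E) by exact: nneg_measurable_indic.
have n2 : nneg_measurable (fun v => (tilt t v * sqdist v w)%:E).
  split; last by move=> v; rewrite lee_fin mulr_ge0 ?sqdist_ge0// ltW// tilt_gt0.
  by apply/measurable_EFinP; exact: (measurable_funM (measurable_tilt t) (measurable_sqdist w)).
have n1' := nneg_measurableZ (expR_ge0 (n%:R * a)) n1; have n2' := nneg_measurableZ (ltW k0) n2.
have zZ : Zint p q t = z%:E by rewrite -zE mom0E.
have := @le_stat_int R p q n _ _ (nneg_measurable_tilt t) (nneg_measurableD n1' n2') (fun v _ _ => ineq v).
rewrite (stat_int_tilt n zZ) (stat_intD _ _ _ n1' n2') !stat_intZ ?expR_ge0 ?(ltW k0)//.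
rewrite stat_int_sqdist -EFinM.
move: (stat_int_ge0 p q n n1).
case: (stat_int p q n (fun v => (\1_S v)%:E)) => [W||]//; last by move=> _ _; exact: leey.
rewrite -EFinM -EFinD !lee_fin => W0 h.
have zn : 0 < z ^+ n by rewrite exprn_gt0.
have h2 : k * (z ^+ n * (n%:R * s2)) <= z ^+ n / 2.
  rewrite mulrCA ler_pM2l// /k mulrC ler_pdivrMr ?exprn_gt0 ?mulr_gt0//.
  rewrite exprMn expr2; move: hn n0; move: (d ^+ 2) (n%:R) => d2 N; nra.
rewrite mulNr expRN ler_pdivrMr ?expR_gt0//; lra.
Qed.

End SecondMoment.
End Tilting.

(** * The rate function *)

Section Rate.
Context {R : realType}.
Notation mu := (@lebesgue_measure R).

Lemma continuous_normrX (r : R) : 1 <= r -> continuous (fun x : R => `|x| `^ r).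
Proof.
move=> r1 x; have [->|x0] := eqVneq x 0.
  rewrite /continuous_at normr0 powR0; last by rewrite gt_eqF// (lt_le_trans ltr01).
  apply/cvgrPdist_lt => e e0; near=> y.
  have y1 : `|y| <= 1.
    by rewrite -[y]subr0 distrC; near: y; apply: (@cvgr_dist_le _ _ _ _ _ id) => //; exact: cvg_id.
  rewrite sub0r normrN ger0_norm ?powR_ge0//.
  apply: (@le_lt_trans _ _ `|y|).
    have [->|yn] := eqVneq y 0.
      by rewrite normr0 powR0// gt_eqF// (lt_le_trans ltr01).
    by rewrite ge1r_powR// normr_gt0 yn.
  by rewrite -[y]subr0 distrC; near: y; apply: (@cvgr_dist_lt _ _ _ _ _ id) => //; exact: cvg_id.
have E : {near x, (fun y : R => expR (r * ln `|y|)) =1 (fun y => `|y| `^ r)}.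
  have : \forall y \near x, y != 0.
    by have := open_neq; move=> _; apply: (@open_nbhs_nbhs R x); split => //; exact: open_neq.
  by apply: filterS => y y0; rewrite /powR normr_eq0 (negbTE y0).
rewrite /continuous_at -(nbhs_singleton E).
apply: (cvg_trans (near_eq_cvg E)).
apply: (@continuous_comp _ _ _ (fun y : R => r * ln `|y|) expR); last exact: continuous_expR.
apply: (@continuousM _ R^o (fun=> r) (fun y : R => ln `|y|)); first exact: cst_continuous.
apply: (@continuous_comp _ _ _ (fun y : R => `|y|) (@ln R)); first exact: norm_continuous.
by apply: continuous_ln; rewrite normr_gt0.
Unshelve. all: end_near. Qed.

Variables p q : R.
Hypotheses (q1 : 1 <= q) (qp : q < p).

Let q0 : 0 < q := lt_le_trans ltr01 q1.
Let p0 : 0 < p := lt_trans q0 qp.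

(** This is Z(0, -1/p), by [Zint_Gamma]. *)
Definition Cnorm : R := 2 * p `^ p^-1 * Gamma (1 + p^-1).

Lemma Cnorm_gt0 : 0 < Cnorm. Proof. exact: (Gamma_gt0 q1 qp). Qed.

(* The limit of (1/n) ln (volume of {N_p <= n}). *)
Definition growth_rate : R := p^-1 + ln Cnorm.

(** The rate in the variable x = z^q. Ranging over real values [z] of the partition function omits
    the parameters with infinite Z, whose terms would be -oo. *)
Definition Krate (x : R) : \bar R := ereal_sup
  [set y | exists t z, Zint p q t = z%:E /\ y = (t.1 * x + t.2 - ln z + growth_rate)%:E].

(** The factor exp (- |s|^p / p) of the density shifts the second parameter by 1/p; the terms y / p
    in the bounds on [Lambda_star] come from this shift. *)
Lemma LambdaE (u : R * R) :
  Lambda p q u = lne ((Cnorm^-1)%:E * Zint p q (u.1, u.2 - p^-1)%R)%E.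
Proof.
rewrite /Lambda; congr lne; rewrite /Zint -ge0_integralZl//.
- apply: eq_integral => s _; rewrite -EFinM; congr (_%:E).
  rewrite /pgen_density -/Cnorm /ew/= mulrA -expRD mulrC; congr (_ * expR _); ring.
- by apply/measurable_EFinP; exact: measurable_ew.
- by move=> s _; rewrite lee_fin ew_ge0.
- by rewrite lee_fin invr_ge0 ltW// Cnorm_gt0.
Qed.

Lemma Lambda_fin (u : R * R) z : Zint p q (u.1, u.2 - p^-1) = z%:E ->
  Lambda p q u = (ln z - ln Cnorm)%:E.
Proof.
move=> zE; have z0 : 0 < z by rewrite -lte_fin -zE Zint_gt0.
have C0 := Cnorm_gt0.
rewrite LambdaE zE -EFinM lne_EFin ?mulr_gt0 ?invr_gt0//.
by rewrite lnM ?posrE ?invr_gt0// lnV ?posrE// addrC.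
Qed.

Lemma Zint_pinfty_or_fin (t : R * R) : Zint p q t = +oo%E \/ exists z, Zint p q t = z%:E.
Proof.
have := Zint_gt0 q1 qp t; case: (Zint p q t) => [z _|_|//]; last by left.
by right; exists z.
Qed.

Lemma Lambda_star_ge (x y : R) t z : Zint p q t = z%:E ->
  ((t.1 * x + t.2 * y - ln z + y / p + ln Cnorm)%:E <= Lambda_star p q (x, y))%E.
Proof.
move=> zE; apply: ereal_sup_ubound; exists (t.1, t.2 + p^-1) => //=.
rewrite (@Lambda_fin _ z) /= ?addrK; last by rewrite -zE; case: (t).
by rewrite -EFinB; congr (_%:E); ring.
Qed.

Lemma Lambda_star_le (x y : R) (B : \bar R) :
  (forall t z, Zint p q t = z%:E ->
     ((t.1 * x + t.2 * y - ln z + y / p + ln Cnorm)%:E <= B)%E) ->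
  (Lambda_star p q (x, y) <= B)%E.
Proof.
move=> H; apply: ge_ereal_sup => _ [u _ <-].
have [uE|[z zE]] := Zint_pinfty_or_fin (u.1, u.2 - p^-1).
  rewrite LambdaE uE gt0_muley ?lte_fin ?invr_gt0 ?Cnorm_gt0//.
  by rewrite addeNy leNye.
rewrite (Lambda_fin zE) -EFinB; apply: le_trans (H _ _ zE).
by rewrite lee_fin le_eqVlt; apply/orP; left; apply/eqP => /=; ring.
Qed.

Lemma Lambda_star_ge0 xy : (0 <= Lambda_star p q xy)%E.
Proof.
case: xy => x y; apply: le_trans (Lambda_star_ge x y (Zint_Gamma q1 qp)).
by rewrite lee_fin le_eqVlt; apply/orP; left; apply/eqP; rewrite -/Cnorm /=; ring.
Qed.

Lemma Krate_ge x t z : Zint p q t = z%:E ->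
  ((t.1 * x + t.2 - ln z + growth_rate)%:E <= Krate x)%E.
Proof. by move=> zE; apply: ereal_sup_ubound; exists t, z. Qed.

(* The scaling [c = y^(1/p) / z1] matches the exponential parameters of the
   two sides; the infimum over [z1] is harmless because the finiteness of
   [Zint t] forces [t.2 <= 0]. *)
Lemma Krate_le_Irate (t : R * R) (z z1 z2 x y z0 : R) :
    Zint p q t = z0%:E -> 0 < z1 <= 1 -> 0 <= z2 -> z = z1 * z2 ->
    0 <= x -> 0 < y -> x `^ q^-1 * y `^ (- p^-1) = z2 ->
  ((t.1 * z `^ q + t.2 - ln z0 + growth_rate + ln z1)%:E <= Lambda_star p q (x, y))%E.
Proof.
move=> zE /andP[z10 z11] z20 zz x0 y0 xy.
have t20 : t.2 <= 0.
  by rewrite leNgt; apply/negP => /(Zint_pinfty q1 qp); rewrite zE.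
have z00 : 0 < z0 by rewrite -lte_fin -zE Zint_gt0.
pose c := y `^ p^-1 / z1.
have yp : 0 < y `^ p^-1 by rewrite powR_gt0.
have c0 : 0 < c by rewrite divr_gt0.
have yE : y = (y `^ p^-1) `^ p by rewrite -powRrM mulVf ?powRr1 ?gt_eqF// ltW.
have cV0 : 0 < c^-1 by rewrite invr_gt0.
have Zc := Zint_scale p q t cV0.
rewrite zE invrK -EFinM in Zc.
apply: le_trans (Lambda_star_ge x y Zc) => /=.
have xE : c^-1 `^ q * x = z `^ q.
  have xq : x = (z2 * y `^ p^-1) `^ q.
    by rewrite -xy powRN (mulfVK (lt0r_neq0 yp)) -powRrM (mulVf (lt0r_neq0 q0)) powRr1.
  rewrite {1}xq -powRM ?invr_ge0 ?(ltW c0) ?mulr_ge0 ?(ltW yp)//.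
  rewrite zz; congr (_ `^ q); rewrite /c; field; rewrite !gt_eqF//.
have yE' : c^-1 `^ p * y = z1 `^ p.
  rewrite {1}yE -powRM ?(ltW cV0) ?(ltW yp)//.
  by congr (_ `^ p); rewrite /c; field; rewrite !gt_eqF.
rewrite mulrAC xE mulrAC yE' (mulrC _ t.1) (mulrC _ t.2) lee_fin.
have h1 : t.2 <= t.2 * z1 `^ p.
  have : z1 `^ p <= 1 `^ p by rewrite ge0_ler_powR ?nnegrE ?(ltW p0) ?(ltW z10).
  by rewrite powR1 => h; rewrite -[leLHS]mulr1 ler_wnM2l.
have h2 : ln (c * z0) = ln y / p - ln z1 + ln z0.
  by rewrite lnM ?posrE// /c ln_div ?posrE// ln_powR mulrC.
(* Here y - ln y >= 1, with equality at y = 1, supplies the summand 1/p of [growth_rate]. *)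
have h3 : p^-1 * (1 + ln y) <= p^-1 * y.
  by rewrite ler_pM2l ?invr_gt0// -[y in leRHS](lnK (x := y)) ?posrE// expR_ge1Dx.
rewrite h2 /growth_rate; move: h1 h3; rewrite mulrDr mulr1 (mulrC p^-1 y) (mulrC p^-1 (ln y)); lra.
Qed.

Lemma I2_ge0 z : (0 <= I2 p q z)%E.
Proof.
rewrite /I2; case: ifP => // _; apply: le_ereal_inf_tmp => _ [xy _ <-].
exact: Lambda_star_ge0.
Qed.

Lemma IrateE z : 0 <= z -> Irate p q z = Krate (z `^ q).
Proof.
move=> z0; rewrite /Irate z0; apply/eqP; rewrite eq_le; apply/andP; split.
  apply: (@le_trans _ _ (I1 1 + I2 p q z)%E).
    by apply: ereal_inf_lbound; exists (1, z) => //=; rewrite mul1r.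
  rewrite /I1 ltr01 lexx/= ln1 oppr0 add0e /I2 z0.
  apply: (@le_trans _ _ (Lambda_star p q (z `^ q, 1))).
    apply: ereal_inf_lbound; exists (z `^ q, 1) => //=; split; first exact: powR_ge0.
    by split => //; rewrite powR1 mulr1 -powRrM mulfV ?powRr1// gt_eqF.
  apply: Lambda_star_le => t z' /(Krate_ge (z `^ q)); apply: le_trans.
  by rewrite lee_fin /growth_rate mulr1 mul1r; lra.
apply: le_ereal_inf_tmp => _ [[z1 z2] /= [z10 [z20 zz]] <-].
rewrite /I1; case: ifPn => [hz1|_]; last first.
  (* Nonnegativity of [I2] excludes the sum of +oo and -oo. *)
  by rewrite addye ?leey// gt_eqF// (lt_le_trans _ (I2_ge0 z2)).
apply: ge_ereal_sup => _ [t [z' [zE ->]]].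
rewrite -[leLHS](_ : (- ln z1)%:E + (t.1 * z `^ q + t.2 - ln z' + growth_rate + ln z1)%:E = _)%E; last first.
  by rewrite -EFinD; congr (_%:E); ring.
rewrite leeD2l// /I2 z20; apply: le_ereal_inf_tmp => _ [[x y] /= [x0 [y0 xy]] <-].
exact: (Krate_le_Irate zE hz1 z20 zz x0 y0 xy).
Qed.

Lemma Irate_lt0 z : z < 0 -> Irate p q z = +oo%E.
Proof. by move=> z0; rewrite /Irate leNgt z0. Qed.

(** For x >= 1 the parameter (T r, - T) contributes at least T (r - 1) - ln Z, up to the constant,
    and [Zint_vanish] makes this arbitrarily large. *)
Lemma Krate_ge1 x : 1 <= x -> Krate x = +oo%E.
Proof.
move=> x1; apply/eqyP => A A0.
have [T T0] := Zint_vanish q1 qp (expR_gt0 (growth_rate - A)).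
have [->//|[z zE]] := Zint_pinfty_or_fin (T * (p / q), - T).
rewrite zE lte_fin -expRD => hz.
apply: le_trans (Krate_ge x zE); rewrite lee_fin /=.
have z0 : 0 < z by rewrite -lte_fin -zE Zint_gt0.
have : ln z < growth_rate - A + T * (p / q - 1) by rewrite -[ltRHS]expRK ltr_ln ?posrE ?expR_gt0.
have : T * (p / q) <= T * (p / q) * x by rewrite ler_peMr// ltW// mulr_gt0// divr_gt0.
lra.
Qed.

(** At x = 0 a parameter (t_1, 0) contributes only - ln Z, and Z tends to 0 as t_1 decreases; [c] is
    solved for so that the value is exactly A. *)
Lemma Krate0 : Krate 0 = +oo%E.
Proof.
apply/eqyP => A A0.
have adm : admissible (- 1, 0 : R) by right; split => //=; lra.
have [z zE] : exists z, Zint p q (- 1, 0) = z%:E.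
  by exists (fine (Zint p q (- 1, 0))); rewrite fineK// Zint_fin.
have z0 : 0 < z by rewrite -lte_fin -zE Zint_gt0.
pose c := expR (A + ln z - growth_rate).
have c0 : 0 < c by exact: expR_gt0.
have := Zint_scale p q (- 1, 0) c0; rewrite zE -EFinM => /(Krate_ge 0).
apply: le_trans; rewrite lee_fin /= !mulr0.
rewrite lnM ?posrE ?invr_gt0// lnV ?posrE// /c expRK; lra.
Qed.

Lemma Irate_ge0 z : (0 <= Irate p q z)%E.
Proof.
have [z0|z0] := leP 0 z; last by rewrite Irate_lt0.
rewrite IrateE//; apply: le_trans (Krate_ge _ (Zint_Gamma q1 qp)).
by rewrite lee_fin le_eqVlt; apply/orP; left; apply/eqP; rewrite -/Cnorm /growth_rate /=; ring.
Qed.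

Lemma Irate_lsc : lower_semicontinuous (Irate p q).
Proof.
move=> z a az; have [z0|z0] := leP 0 z; last first.
  exists [set y | y < 0]; first exact: lt_nbhsl.
  by move=> y /= /Irate_lt0 ->; rewrite ltry.
move: az; rewrite IrateE// => /ereal_sup_gt[_ [t [z' [zE ->]]]].
rewrite lte_fin => az.
(* The absolute value makes the score continuous on all of R; at negative y the rate is infinite
   anyway. *)
exists [set y : R | a < t.1 * `|y| `^ q + t.2 - ln z' + growth_rate].
  have cf : {for z, continuous (fun y : R => t.1 * `|y| `^ q + (t.2 - ln z' + growth_rate))}.
    apply: (@continuousD _ R^o); last exact: cst_continuous.
    apply: (@continuousM _ R^o (fun=> t.1) (fun y : R => `|y| `^ q)); first exact: cst_continuous.
    exact: continuous_normrX.
  have : \forall y \near z, a < t.1 * `|y| `^ q + (t.2 - ln z' + growth_rate).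
    by apply: (cvgr_gt _ cf) => /=; rewrite (ger0_norm z0); lra.
  by apply: filterS => y /= hy; lra.
move=> y /= hy; have [y0|y0] := leP 0 y; last by rewrite Irate_lt0// ltry.
rewrite IrateE//; apply: lt_le_trans (Krate_ge _ zE).
by rewrite lte_fin; move: hy; rewrite ger0_norm.
Qed.

Lemma good_Irate : good_rate_function (Irate p q).
Proof.
split; [exact: Irate_ge0|exact: Irate_lsc|move=> a].
apply: (@subclosed_compact R _ (`[0, 1]%classic : set R)); last 2 first.
- exact: segment_compact.
- move=> z /= Iz; rewrite in_itv/=; apply/andP; split.
    by rewrite leNgt; apply/negP => /Irate_lt0 zE; move: Iz; rewrite zE.
  rewrite leNgt; apply/negP => z1; move: Iz; rewrite IrateE; last by lra.
  rewrite Krate_ge1//; rewrite -(powRr0 z) ler_powR ?(ltW q0)//; lra.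
rewrite -[X in closed X]setCK; apply: open_closedC.
have -> : ~` [set x | (Irate p q x <= a%:E)%E] = [set x | (a%:E < Irate p q x)%E].
  by apply/seteqP; split => x /=; [move/negP; rewrite -ltNge|move=> h; apply/negP; rewrite -ltNge].
rewrite openE => x /= /Irate_lsc[V Vx VI].
by apply: filterS Vx.
Qed.

End Rate.

(** * Volumes of the rescaled events *)

Section Reduction.
Context {R : realType}.
Notation mu := (@lebesgue_measure R).
Variables p q : R.
Hypotheses (q1 : 1 <= q) (qp : q < p).

Let q0 : 0 < q := lt_le_trans ltr01 q1.
Let p0 : 0 < p := lt_trans q0 qp.

Definition stat_vol (n : nat) (S : set (R * R)) : \bar R :=
  stat_int p q n (fun v => (\1_S v)%:E).

Definition rescaled_event (n : nat) (A : set R) : set (R * R) :=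
  [set v | v.2 <= n%:R /\ A ((v.1 / n%:R) `^ q^-1)].

Lemma measurable_rescaled_event n A : measurable A -> measurable (rescaled_event n A).
Proof.
move=> mA; apply: measurableI.
  rewrite -[X in measurable X]setTI.
  by apply: (@measurable_fun_ler _ _ _ _ (fun v : R * R => v.2) (fun=> n%:R)) => //; exact: measurable_snd.
rewrite -[X in measurable X]setTI.
have m1 : measurable_fun [set: R * R] (fun v : R * R => (v.1 / n%:R) `^ q^-1).
  by apply: (measurableT_comp (measurable_powR q^-1)); exact: measurable_funM.
exact: m1.
Qed.

Lemma le_stat_vol n (S1 S2 : set (R * R)) : measurable S1 -> measurable S2 ->
    (forall v, 0 <= v.1 -> 0 <= v.2 -> S1 v -> S2 v) ->
  (stat_vol n S1 <= stat_vol n S2)%E.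
Proof.
move=> m1 m2 S12; apply: le_stat_int; [exact: nneg_measurable_indic|exact: nneg_measurable_indic|].
move=> v v1 v2; rewrite lee_fin !indicE; have [h|_] := boolP (v \in S1) => //.
by rewrite (mem_set (S12 _ v1 v2 (set_mem h))).
Qed.

Lemma stat_vol_ge0 n (S : set (R * R)) : measurable S -> (0 <= stat_vol n S)%E.
Proof. by move=> mS; apply: stat_int_ge0; exact: nneg_measurable_indic. Qed.

Lemma stat_volU n (S S1 S2 : set (R * R)) : measurable S -> measurable S1 -> measurable S2 ->
    (forall v, 0 <= v.1 -> 0 <= v.2 -> S v -> S1 v \/ S2 v) ->
  (stat_vol n S <= stat_vol n S1 + stat_vol n S2)%E.
Proof.
move=> m m1 m2 S12; rewrite /stat_vol -stat_intD; [|exact: nneg_measurable_indic|exact: nneg_measurable_indic].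
apply: le_stat_int; [exact: nneg_measurable_indic|by apply: nneg_measurableD; exact: nneg_measurable_indic|].
move=> v v1 v2; rewrite -EFinD lee_fin !indicE.
have [/set_mem/(S12 _ v1 v2)[] h|_] := boolP (v \in S); last by rewrite addr_ge0.
  by rewrite (mem_set h) lerDl.
by rewrite (mem_set h) lerDr.
Qed.

Lemma vol_stat n (A : set R) : (0 < n)%N -> measurable A ->
  vol n [set s | (lpnorm p s <= 1)%R /\ A (n%:R `^ (p^-1 - q^-1) * lpnorm q s)%R] =
  (((n%:R : R) `^ (- p^-1) ^+ n)%:E * stat_vol n (rescaled_event n A))%E.
Proof.
move=> n0 mA; have nR : 0 < n%:R :> R by rewrite ltr0n.
pose G : set (R * R) := [set v | v.2 `^ p^-1 <= 1 /\ A (n%:R `^ (p^-1 - q^-1) * v.1 `^ q^-1)].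
have mG : measurable G.
  apply: measurableI; rewrite -[X in measurable X]setTI.
    have m1 : measurable_fun [set: R * R] (fun v : R * R => v.2 `^ p^-1).
      by apply: (measurableT_comp (measurable_powR p^-1)); exact: measurable_snd.
    by apply: (@measurable_fun_ler _ _ _ _ (fun v : R * R => v.2 `^ p^-1) (fun=> 1)).
  have m1 : measurable_fun [set: R * R] (fun v : R * R => n%:R `^ (p^-1 - q^-1) * v.1 `^ q^-1).
    apply: measurable_funM => //.
    by apply: (measurableT_comp (measurable_powR q^-1)); exact: measurable_fst.
  exact: m1.
transitivity (stat_int p q n (fun v => (\1_G v)%:E)); first by rewrite -iint_stat.
pose c : R := n%:R `^ (- p^-1).
have c0 : 0 < c by rewrite powR_gt0.
have cp : c `^ p = n%:R^-1.
  by rewrite /c -powRrM mulNr mulVf ?powR_inv1 ?(ltW nR)// gt_eqF.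
have := stat_int_scale p q n c0 (nneg_measurable_indic mG).
have -> : stat_int p q n (fun v => (\1_G (c `^ q * v.1, c `^ p * v.2)%R)%:E) = stat_vol n (rescaled_event n A).
  apply: eq_stat_int.
  - split; last by move=> v; rewrite lee_fin.
    apply: (measurableT_comp (nneg_measurable_indic mG).1 (_ : measurable_fun setT (fun v : R * R => (c `^ q * v.1, c `^ p * v.2)))).
    by apply: measurable_fun_pair; apply: measurable_funM.
  - by apply: nneg_measurable_indic; exact: measurable_rescaled_event.
  move=> v v1 v2; congr (_%:E); rewrite !indicE; congr ((nat_of_bool _)%:R).
  have E1 : ((c `^ p * v.2) `^ p^-1 <= 1) = (v.2 <= n%:R).
    have -> : (v.2 <= n%:R) = (n%:R^-1 * v.2 <= 1) by rewrite mulrC ler_pdivrMr// mul1r.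
    rewrite cp.
    have h0 : 0 <= n%:R^-1 * v.2 by rewrite mulr_ge0// invr_ge0 ltW.
    have -> : (n%:R^-1 * v.2) `^ p^-1 <= 1 = (n%:R^-1 * v.2 <= 1).
      have pV : 0 < p^-1 by rewrite invr_gt0.
      have := powR_le_root pV h0 ler01; rewrite invrK powR1; exact.
    by [].
  have E2 : n%:R `^ (p^-1 - q^-1) * (c `^ q * v.1) `^ q^-1 = (v.1 / n%:R) `^ q^-1.
    rewrite powRM ?powR_ge0// -powRrM mulfV ?powRr1 ?(ltW c0) ?gt_eqF// mulrA.
    rewrite /c -powRD ?(gt_eqF nR) ?implybT//.
    rewrite powRM ?invr_ge0 ?(ltW nR)// (powRVl _ (ltW nR)) -powRN mulrC.
    by congr (_ * _ `^ _); ring.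
  by rewrite /rescaled_event /G; apply/idP/idP => /set_mem /= [h1 h2]; apply/mem_set => /=;
    move: h1 h2; rewrite E1 E2.
move=> ->; rewrite muleA -EFinM -exprMn mulfV ?gt_eqF// expr1n mul1e.
by [].
Qed.

(** The Jacobian of the dilation by n^(1/p) cancels between the event and the ball. *)
Lemma lawZ_stat n (A : set R) : (0 < n)%N -> measurable A ->
  lawZ p q n A = (stat_vol n (rescaled_event n A) * (fine (stat_vol n (rescaled_event n setT)))^-1%:E)%E.
Proof.
move=> n0 mA; have nR : 0 < n%:R :> R by rewrite ltr0n.
rewrite /lawZ vol_stat//.
have -> : vol n (lpball p) = vol n [set s | (lpnorm p s <= 1)%R /\ setT (n%:R `^ (p^-1 - q^-1) * lpnorm q s)%R].
  by congr vol; apply/seteqP; split => s //= [].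
rewrite vol_stat//; set k := (n%:R `^ _) ^+ n.
have k0 : 0 < k by rewrite exprn_gt0// powR_gt0.
have -> : fine (k%:E * stat_vol n (rescaled_event n setT)) = k * fine (stat_vol n (rescaled_event n setT)).
  have := stat_vol_ge0 n (measurable_rescaled_event n measurableT).
  case: (stat_vol n (rescaled_event n setT)) => [r||]//= _.
  by rewrite gt0_muley ?lte_fin//= mulr0.
rewrite invfM EFinM muleACA -EFinM mulfV ?gt_eqF// mul1e.
by [].
Qed.

(** Chernoff at (0, -1/p), where - t_2 + ln Z(0, t_2) is smallest; that minimum is [growth_rate]. *)
Lemma rescaled_ball_upper n : (stat_vol n (rescaled_event n setT) <= (expR (n%:R * growth_rate p))%:E)%E.
Proof.
have C0 := Cnorm_gt0 q1 qp.
have := @chernoff_stat_int R p q q1 qp n (0, - p^-1) (Cnorm p) (rescaled_event n setT) (- (n%:R / p)) (measurable_rescaled_event n measurableT) (Zint_Gamma q1 qp).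
move=> /(_ _)/le_trans; apply.
  move=> v [h _] _ _ /=; rewrite mul0r add0r mulNr lerN2 mulrC.
  by rewrite ler_wpM2r// invr_ge0 ltW.
by rewrite opprK /growth_rate lee_fin mulrDr expRD [X in _ <= _ * X]expRM_natl lnK ?posrE.
Qed.

(** A window around the tilted means need not lie in the event, but its image under the dilation by
    c does, and the dilation multiplies volume by c^n. The final [- d] pays for the factor 1/2 of
    Chebyshev, since exp (n d) >= 2 once n d >= 1. *)
Lemma scaled_lower_bound (t : R * R) (z Q P c d : R) (S : nat -> set (R * R)) :
    admissible t -> mom p q 0 t = z -> mom p q q t = Q * z -> mom p q p t = P * z ->
    0 < c -> 0 < d -> (forall n, measurable (S n)) ->
    (forall n v, 0 <= v.1 -> 0 <= v.2 -> `|v.1 - n%:R * Q| < n%:R * d ->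
      `|v.2 - n%:R * P| < n%:R * d -> S n (c `^ q * v.1, c `^ p * v.2)) ->
  exists N : nat, forall n, (N <= n)%N ->
    ((expR (n%:R * (ln c + ln z - (t.1 * Q + t.2 * P + d * (`|t.1| + `|t.2|)) - d)))%:E
      <= stat_vol n (S n))%E.
Proof.
move=> ad zE QE PE c0 d0 mS H.
have z0 : 0 < z by rewrite -zE; exact: mom_gt0.
have [N HN] := tilt_lower_bound q1 qp ad zE QE PE d0.
exists (maxn N (Num.truncn d^-1).+1) => n; rewrite geq_max => /andP[Nn nd].
have nd1 : 1 <= n%:R * d.
  rewrite -ler_pdivrMr// div1r ltW//; apply: lt_le_trans (_ : (Num.truncn d^-1).+1%:R <= _).
    exact: truncnS_gt.
  by rewrite ler_nat.
pose g v : \bar R := (\1_(S n) v)%:E.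
have ng : nneg_measurable g by exact: nneg_measurable_indic.
have := stat_int_scale p q n c0 ng.
set W := stat_int p q n (fun v => g (c `^ q * v.1, c `^ p * v.2)) => WE.
have ngc : nneg_measurable (fun v => g (c `^ q * v.1, c `^ p * v.2)).
  split; last by move=> v; rewrite lee_fin.
  apply: (measurableT_comp ng.1 (_ : measurable_fun setT (fun v : R * R => (c `^ q * v.1, c `^ p * v.2)))).
  by apply: measurable_fun_pair; apply: measurable_funM.
have : ((z ^+ n / 2 * expR (- n%:R * (t.1 * Q + t.2 * P + d * (`|t.1| + `|t.2|))))%:E <= W)%E.
  apply: le_trans (HN n Nn) _; apply: le_stat_int => //.
    by apply: nneg_measurable_indic; exact: measurable_window.
  move=> v v1 v2; rewrite lee_fin !indicE; case: (boolP (v \in _)) => // /set_mem[h1 h2].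
  by rewrite (mem_set (H n v v1 v2 h1 h2)).
rewrite WE; set a := t.1 * Q + _ + _ => h.
have cn : 0 < c ^+ n by rewrite exprn_gt0.
have -> : stat_vol n (S n) = ((c ^+ n)%:E * ((c^-1 ^+ n)%:E * stat_int p q n g))%E.
  by rewrite muleA -EFinM -exprMn mulfV ?gt_eqF// expr1n mul1e.
apply: le_trans (lee_wpmul2l _ h); last by rewrite lee_fin ltW.
rewrite -EFinM lee_fin.
have -> : c ^+ n = expR (n%:R * ln c) by rewrite expRM_natl lnK.
have -> : z ^+ n = expR (n%:R * ln z) by rewrite expRM_natl lnK.
have -> : n%:R * (ln c + ln z - a - d) = n%:R * ln c + (n%:R * ln z + (- n%:R * a + - (n%:R * d))) by ring.
rewrite expRD ler_wpM2l ?expR_ge0// expRD -mulrA ler_wpM2l ?expR_ge0// expRD mulrC.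
rewrite ler_wpM2r ?expR_ge0// expRN lef_pV2 ?posrE ?expR_gt0//.
by apply: le_trans (expR_ge1Dx _); rewrite -[2]/(1 + 1) lerD2l.
Qed.

(* The tilt (0, -1/p) has mean N_p / n equal to some P; rescaling from P to 1
   can only increase the exponent since P - ln P >= 1, so P = 1 is not needed. *)
Lemma rescaled_ball_lower (e : R) : 0 < e -> exists N : nat, forall n, (N <= n)%N ->
  ((expR (n%:R * (growth_rate p - e)))%:E <= stat_vol n (rescaled_event n setT))%E.
Proof.
move=> e0; have C0 := Cnorm_gt0 q1 qp.
have ad : admissible (0, - p^-1 : R) by left; rewrite /= oppr_lt0 invr_gt0.
have zE : mom p q 0 (0, - p^-1) = Cnorm p.
  by apply: EFin_inj; rewrite mom0E//; exact: Zint_Gamma.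
pose Q := mom p q q (0, - p^-1) / Cnorm p; pose P := mom p q p (0, - p^-1) / Cnorm p.
have QE : mom p q q (0, - p^-1) = Q * Cnorm p by rewrite /Q divfK// gt_eqF.
have PE : mom p q p (0, - p^-1) = P * Cnorm p by rewrite /P divfK// gt_eqF.
have P0 : 0 < P := divr_gt0 (mom_gt0 q1 qp (ltW p0) ad) C0.
clearbody Q P.
(* The losses are d for the factor 1/2, d / p for the window width and d / p for scaling by P + d
   instead of P. *)
pose d := e / (1 + 2 / p).
have w0 : 0 < 1 + 2 / p by rewrite addr_gt0// divr_gt0.
have d0 : 0 < d := divr_gt0 e0 w0.
have dE : d + d * 2 / p = e.
  by rewrite -{1}[d]mulr1 -[d * 2 / p]mulrA -mulrDr divfK// gt_eqF.
clearbody d.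
pose c := (P + d) `^ (- p^-1).
have Pd : 0 < P + d by rewrite addr_gt0.
have c0 : 0 < c by exact: powR_gt0.
have cp : c `^ p * (P + d) = 1.
  by rewrite /c -powRrM mulNr (mulVf (lt0r_neq0 p0)) powR_inv1 ?(ltW Pd)// mulVf// gt_eqF.
have [|N HN] := @scaled_lower_bound (0, - p^-1) (Cnorm p) Q P c d (fun n => rescaled_event n setT)
    ad zE QE PE c0 d0 (fun n => measurable_rescaled_event n measurableT).
  move=> n v v1 v2 _ h; split => //=.
  apply: (@le_trans _ _ (c `^ p * ((P + d) * n%:R))); last by rewrite mulrA cp mul1r.
  rewrite ler_wpM2l ?powR_ge0//.
  have /ltW := le_lt_trans (ler_norm _) h.
  by rewrite lerBlDr mulrDl addrC (mulrC d) (mulrC P).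
exists N => n /HN; apply: le_trans; rewrite lee_fin ler_expR ler_wpM2l//= normr0 normrN.
rewrite (gtr0_norm (_ : 0 < p^-1)) ?invr_gt0//.
rewrite /c ln_powR /growth_rate mul0r !add0r.
have h : 1 + ln (P + d) <= P + d by rewrite -[leRHS]lnK ?posrE// expR_ge1Dx.
have iV : 0 <= p^-1 by rewrite invr_ge0 ltW.
have := ler_wpM2l iV h; move: dE {HN cp c0 c zE QE PE h}.
move: (ln (P + d)) (ln (Cnorm p)) (p^-1) => L K i; lra.
Qed.

Definition strip (n : nat) (x s : R) : set (R * R) :=
  [set v | v.2 <= n%:R /\ `|v.1 / n%:R - x| <= s].

Lemma measurable_strip n x s : measurable (strip n x s).
Proof.
apply: measurableI; rewrite -[X in measurable X]setTI.
  by apply: (@measurable_fun_ler _ _ _ _ (fun v : R * R => v.2) (fun=> n%:R)) => //; exact: measurable_snd.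
apply: (@measurable_fun_ler _ _ _ _ (fun v : R * R => `|v.1 / n%:R - x|) (fun=> s)) => //.
apply: (measurableT_comp (@normr_measurable R setT)); apply: measurable_funB => //.
by apply: measurable_funM => //; exact: measurable_fst.
Qed.

Lemma strip_lower (x e k s : R) : 0 < x < 1 -> 0 < e -> 0 < s -> (Krate p q x <= k%:E)%E ->
  exists N : nat, forall n, (N <= n)%N ->
  ((expR (n%:R * (growth_rate p - k - e)))%:E <=
   stat_vol n (strip n x s))%E.
Proof.
move=> x01 e0 s0 Kk; have /andP[x0 x1] := x01.
have [t [P [ad QE PE /andP[P0 P1] tP]]] := tilt_exists q1 qp x01.
have [z zE] : exists z, mom p q 0 t = z by exists (mom p q 0 t).
have z0 : 0 < z by rewrite -zE; exact: mom_gt0.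
rewrite zE in QE PE.
have score : t.1 * x + t.2 - ln z + growth_rate p <= k.
  rewrite -lee_fin; apply: le_trans Kk; apply: Krate_ge.
  by rewrite -zE mom0E.
(* d w collects the window width d (|t.1| + |t.2|), the factor 1/2 (d) and the contraction (at most
   d / p). *)
pose w := `|t.1| + `|t.2| + 1 + p^-1.
have w0 : 0 < w.
  by rewrite addr_gt0 ?invr_gt0// ltr_wpDl ?addr_ge0.
(* The factor 3: the window moves N_q / n by at most d, and the contraction by at most d y <= 2
   d. *)
have [d [d0 d1 ds de]] : exists d, [/\ 0 < d, d <= 1, 3 * d <= s & d * w <= e].
  exists (Num.min 1 (Num.min (s / 3) (e / w))); split.
  - by rewrite !lt_min ltr01 !divr_gt0.
  - by rewrite ge_min lexx.
  - by rewrite mulrC -ler_pdivlMr// !ge_min lexx orbT.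
  - by rewrite -ler_pdivlMr// !ge_min lexx !orbT.
(* The window allows N_p up to n (P + d) <= n (1 + d); this contraction brings it below n. *)
pose c := (1 + d) `^ (- p^-1).
have d1' : 0 < 1 + d by rewrite addr_gt0.
have c0 : 0 < c by exact: powR_gt0.
have cp : c `^ p = (1 + d)^-1.
  by rewrite /c -powRrM mulNr (mulVf (lt0r_neq0 p0)) powR_inv1 ?(ltW d1').
have c1 : c <= 1.
  by rewrite /c -[leRHS](powRr0 (1 + d)) ler_powR ?lerDl ?(ltW d0)// oppr_le0 invr_ge0 ltW.
have cq1 : c `^ q <= 1.
  by rewrite -[leRHS](powRr0 c) ger_powR ?c0// ltW.
have cq2 : 1 - d <= c `^ q.
  apply: (@le_trans _ _ (c `^ p)); last by rewrite ger_powR ?c0// ltW.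
  rewrite cp -(ler_pM2r d1') mulVf ?(gt_eqF d1')//.
  by rewrite (_ : (1 - d) * (1 + d) = 1 - d ^+ 2) ?gerBl ?sqr_ge0//; ring.
have [|N HN] := @scaled_lower_bound t z x P c d (fun n => strip n x s)
    ad zE QE PE c0 d0 (fun n => measurable_strip n x s).
  move=> n v v1 v2 h1 h2; rewrite /strip/=.
  have n0 : 0 < n%:R :> R.
    by rewrite -(pmulr_lgt0 _ d0); apply: le_lt_trans h1.
  split.
    rewrite cp mulrC ler_pdivrMr//.
    have /ltW := le_lt_trans (ler_norm _) h2.
    rewrite lerBlDr -mulrDr => /le_trans; apply.
    by rewrite ler_pM2l// addrC lerD2r.
  pose y := v.1 / n%:R.
  have y0 : 0 <= y by rewrite divr_ge0// ltW.
  have hy : `|y - x| <= d.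
    have -> : y - x = (v.1 - n%:R * x) / n%:R by rewrite mulrBl (mulrC n%:R x) mulfK// gt_eqF.
    by rewrite normrM normfV (gtr0_norm n0) ler_pdivrMr// (mulrC d) ltW.
  rewrite -mulrA -/y ler_norml.
  move: hy; rewrite ler_norml => /andP[hy1 hy2].
  move: (c `^ q) cq1 cq2 => cq cq1 cq2.
  have cy1 : cq * y <= y by rewrite ler_piMl.
  have cy2 : (1 - d) * y <= cq * y by rewrite ler_wpM2r.
  have dy : d * y <= d * 2 by rewrite ler_wpM2l ?(ltW d0)//; move: hy2 d1 x1; clear; move=> *; lra.
  move: cy1 cy2 dy hy1 hy2 ds d0; clear; move: (cq * y) => u *.
  apply/andP; split; lra.
exists N => n /HN; apply: le_trans; rewrite lee_fin ler_expR ler_wpM2l//.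
(* By [tP] the exponent contains t.2 instead of t.2 P, as the score does, even where P < 1. *)
rewrite tP /c ln_powR.
have h : ln (1 + d) <= d by rewrite -ler_expR lnK ?posrE// expR_ge1Dx.
have iV : 0 <= p^-1 by rewrite invr_ge0 ltW.
have := ler_wpM2l iV h; move: score de; rewrite /w {HN cq2 cq1 c1 cp c0 c h zE QE PE Kk ad tP w0 w}.
move: (ln (1 + d)) (growth_rate p) (ln z) (p^-1) (`|t.1|) (`|t.2|) => L K Lz i a b; lra.
Qed.

End Reduction.

(** * The large deviation principle *)

Section LimSup.
Context {R : realType}.

Lemma limn_esup_le_near (u : (\bar R)^nat) (l : \bar R) :
  (exists N, forall n, (N <= n)%N -> (u n <= l)%E) -> (limn_esup u <= l)%E.
Proof.
move=> [N H]; apply: (@le_trans _ _ (ereal_sup [set u n | n in [set n | (N <= n)%N]])).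
  by apply: ereal_inf_lbound; exists [set n | (N <= n)%N] => //; exists N.
by apply: ge_ereal_sup => _ [n /= Nn <-]; exact: H.
Qed.

Lemma limn_einf_ge_near (u : (\bar R)^nat) (l : \bar R) :
  (exists N, forall n, (N <= n)%N -> (l <= u n)%E) -> (l <= limn_einf u)%E.
Proof.
move=> [N H]; rewrite /limn_einf leeNr; apply: limn_esup_le_near.
by exists N => n /H; rewrite leeN2.
Qed.

Lemma lne_ge_expR (n : nat) (a : R) (x : \bar R) : ((expR (n.+1%:R * a))%:E <= x)%E ->
  (a%:E <= lne x * (n.+1%:R^-1)%:E)%E.
Proof.
have nR : 0 < n.+1%:R :> R by [].
case: x => [r|_|//]; last by rewrite gt0_mulye ?leey// lte_fin invr_gt0.
rewrite lee_fin => h; have r0 : 0 < r := lt_le_trans (expR_gt0 _) h.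
rewrite lne_EFin// lee_fin ler_pdivlMr// mulrC.
by rewrite -ler_expR lnK ?posrE.
Qed.

Lemma lne_le_expR (n : nat) (a : R) (x : \bar R) : (x <= (expR (n.+1%:R * a))%:E)%E ->
  (lne x * (n.+1%:R^-1)%:E <= a%:E)%E.
Proof.
have nR : 0 < n.+1%:R :> R by [].
have ninf : (-oo * (n.+1%:R^-1)%:E <= a%:E)%E.
  by rewrite gt0_mulNye ?leNye// lte_fin invr_gt0.
case: x => [r|//|//]; rewrite lee_fin => h.
have [r0|r0] := leP r 0; first by rewrite le0_lneNy ?lee_fin.
by rewrite lne_EFin// lee_fin ler_pdivrMr// mulrC -ler_expR lnK ?posrE.
Qed.

Lemma continuous_powR_gt0 (r x : R) : 0 < x -> {for x, continuous (fun y : R => y `^ r)}.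
Proof.
move=> x0; apply: differentiable_continuous; apply/derivable1_diffP.
by apply: derivable_powR; rewrite in_itv/= x0.
Qed.

End LimSup.

Section LargeDeviations.
Context {R : realType}.
Variables p q : R.
Hypotheses (q1 : 1 <= q) (qp : q < p).

Let q0 : 0 < q := lt_le_trans ltr01 q1.
Let p0 : 0 < p := lt_trans q0 qp.

Lemma rescaled_ball_fin n : exists2 V, 0 <= V & stat_vol p q n (rescaled_event q n setT) = V%:E.
Proof.
have := rescaled_ball_upper q1 qp n; have := stat_vol_ge0 p q n (measurable_rescaled_event q n measurableT).
by case: (stat_vol _ _ _ _) => [V|//|//]; rewrite lee_fin => V0 _; exists V.
Qed.

Lemma lawZ_lower (A : set R) (z : R) : measurable A -> A^° z ->
  (- Irate p q z <= limn_einf (fun n => lne (lawZ p q n.+1 A) * (n.+1%:R^-1)%:E))%E.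
Proof.
move=> mA Az.
have [IZ|] := eqVneq (Irate p q z) +oo%E; first by rewrite IZ leNye.
have := Irate_ge0 q1 qp z.
case Iz : (Irate p q z) => [k||]//= k0 _.
have z0 : 0 <= z by rewrite leNgt; apply/negP => /(Irate_lt0 p q); rewrite Iz.
have Kz : Krate p q (z `^ q) = k%:E by rewrite -IrateE.
(* A finite rate excludes the endpoints x = 0 and x >= 1, where no tilt is available. *)
have x0 : 0 < z `^ q.
  rewrite lt_neqAle powR_ge0 andbT eq_sym; apply/eqP => xz.
  by have := Krate0 q1 qp; rewrite -xz Kz.
have x1 : z `^ q < 1 by rewrite ltNge; apply/negP => /(Krate_ge1 q1 qp); rewrite Kz.
set x := z `^ q in Kz x0 x1.
have xz : x `^ q^-1 = z by rewrite /x -powRrM mulfV ?powRr1// gt_eqF.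
have [s s0 sA] : exists2 s, 0 < s & forall y, `|y - x| <= s -> A (y `^ q^-1).
  have Ax : nbhs (x `^ q^-1) A by rewrite xz.
  have := continuous_powR_gt0 (r := q^-1) x0 Ax.
  move=> /nbhs_ballP[e /= e0 eA]; exists (e / 2); first by rewrite divr_gt0.
  move=> y hy; apply: eA; rewrite /ball/= distrC; apply: le_lt_trans hy _.
  by rewrite ltr_pdivrMr// ltr_pMr// ltr1n.
apply/lee_addgt0Pr => e e0; rewrite -leeBlDr// -EFinN -EFinB; apply: limn_einf_ge_near.
have x01 : 0 < x < 1 by rewrite x0.
have [|N HN] := strip_lower q1 qp x01 e0 s0 (k := k); first by rewrite Kz.
exists N => n Nn; apply: (@lne_ge_expR _ _ (- k - e)).
have mS := measurable_rescaled_event q n.+1 mA.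
rewrite lawZ_stat//.
have hW := HN n.+1 (leqW Nn).
have TS : (stat_vol p q n.+1 (strip n.+1 x s) <= stat_vol p q n.+1 (rescaled_event q n.+1 A))%E.
  apply: le_stat_vol => //; first exact: measurable_strip.
  by move=> v _ _ [h1 h2]; split => //; exact: sA.
have := le_trans hW TS.
have [V V0 VE] := rescaled_ball_fin n.+1.
have := rescaled_ball_upper q1 qp n.+1; rewrite VE lee_fin /= => VU.
have Vp : (stat_vol p q n.+1 (rescaled_event q n.+1 A) <= V%:E)%E.
  by rewrite -VE; apply: le_stat_vol => //; [exact: measurable_rescaled_event|move=> v _ _ []].
move: Vp; have := stat_vol_ge0 p q n.+1 mS.
case: (stat_vol _ _ _ _) => [W|//|//]; rewrite -EFinM !lee_fin => W0 WV hW'.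
have V1 : 0 < V by apply: lt_le_trans WV; apply: lt_le_trans hW'; exact: expR_gt0.
rewrite ler_pdivlMr//; apply: le_trans hW'.
apply: le_trans (ler_wpM2l (expR_ge0 _) VU) _.
rewrite -expRD ler_expR -mulrDr ler_wpM2l//.
by rewrite le_eqVlt; apply/orP; left; apply/eqP; ring.
Qed.

(** * Upper bound by a finite cover *)

Section UpperBound.
Variables (A : set R) (a : R).
Hypothesis mA : measurable A.

(* The parameter [t] of the Chernoff bound certifies the rate [a] on [S]. *)
Definition certified (S : set R) : Prop := exists t z,
  Zint p q t = z%:E /\ forall y, 0 <= y -> S y -> a <= t.1 * y `^ q + t.2 - ln z + growth_rate p.

(** The constant [C], uniform in n, makes the property stable under finite unions; it is lost on the
    exponential scale. *)
Definition vol_bounded (S : set R) : Prop := exists2 C, 0 <= C & forall n : nat,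
  (stat_vol p q n.+1 (rescaled_event q n.+1 S) <= (C * expR (n.+1%:R * (growth_rate p - a)))%:E)%E.

(** Finiteness of Z forces t.2 <= 0, so N_p <= n gives t.2 N_p >= t.2 n and the certificate becomes
    a Chernoff exponent. *)
Lemma certified_bounded (S : set R) : measurable S -> certified S -> vol_bounded S.
Proof.
move=> mS [t [z [zE H]]]; exists 1 => // n; rewrite mul1r.
have z0 : 0 < z by rewrite -lte_fin -zE Zint_gt0.
have t20 : t.2 <= 0.
  by rewrite leNgt; apply/negP => /(Zint_pinfty q1 qp); rewrite zE.
have nR : 0 < n.+1%:R :> R by [].
have := @chernoff_stat_int R p q q1 qp n.+1 t z (rescaled_event q n.+1 S) (n.+1%:R * (a - growth_rate p + ln z)) (measurable_rescaled_event q n.+1 mS) zE.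
move=> /(_ _)/le_trans; apply; last first.
  have -> : z ^+ n.+1 = expR (n.+1%:R * ln z) by rewrite expRM_natl lnK.
  by rewrite -expRD lee_fin ler_expR -mulrN -mulrDr ler_wpM2l//; lra.
move=> v [h1 h2] v1 v2; have := H _ (powR_ge0 _ _) h2.
have -> : ((v.1 / n.+1%:R) `^ q^-1) `^ q = v.1 / n.+1%:R.
  by rewrite -powRrM (mulVf (lt0r_neq0 q0)) powRr1// divr_ge0.
move=> h3; have h4 : t.2 * n.+1%:R <= t.2 * v.2 by rewrite ler_wnM2l.
have h5 : n.+1%:R * (a - growth_rate p + ln z) <= n.+1%:R * (t.1 * (v.1 / n.+1%:R) + t.2).
  by rewrite ler_wpM2l//; move: h3; move: (v.1 / _) (ln z) (growth_rate p) => u w k h3; lra.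
apply: (le_trans h5); rewrite mulrDr (mulrC _ t.2) mulrCA (mulrC n.+1%:R) divfK ?gt_eqF//.
by rewrite lerD2l.
Qed.

Lemma vol_boundedS (S1 S2 : set R) : measurable S1 -> measurable S2 ->
  (forall y, 0 <= y -> S1 y -> S2 y) -> vol_bounded S2 -> vol_bounded S1.
Proof.
move=> m1 m2 S12 [C C0 H]; exists C => // n; apply: le_trans (H n).
apply: le_stat_vol; [exact: measurable_rescaled_event|exact: measurable_rescaled_event|].
by move=> v _ _ [h1 h2]; split => //; apply: S12 => //; exact: powR_ge0.
Qed.

Lemma vol_boundedU (S1 S2 : set R) : measurable S1 -> measurable S2 ->
  vol_bounded S1 -> vol_bounded S2 -> vol_bounded (S1 `|` S2).
Proof.
move=> m1 m2 [C1 C10 H1] [C2 C20 H2]; exists (C1 + C2); first exact: addr_ge0.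
move=> n; rewrite mulrDl EFinD; apply: le_trans (leeD (H1 n) (H2 n)).
apply: stat_volU; try by apply: measurable_rescaled_event => //; exact: measurableU.
by move=> v _ _ [h1 [h2|h2]]; [left|right].
Qed.

Lemma certified_near (z : R) : 0 <= z -> (a%:E < Irate p q z)%E ->
  exists U : set R, [/\ open U, U z & certified U].
Proof.
move=> z0; rewrite IrateE// => /ereal_sup_gt[_ [t [z' [zE ->]]]].
rewrite lte_fin => az.
pose f (y : R) := t.1 * `|y| `^ q + (t.2 - ln z' + growth_rate p).
have cf (y : R) : {for y, continuous (fun y : R => t.1 * `|y| `^ q + (t.2 - ln z' + growth_rate p))}.
  apply: (@continuousD _ R^o); last exact: cst_continuous.
  apply: (@continuousM _ R^o (fun=> t.1) (fun y : R => `|y| `^ q)); first exact: cst_continuous.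
  exact: (continuous_normrX q1).
exists (f @^-1` [set u | a < u]); split.
- by apply: open_comp; [move=> y _; exact: (cf y)|exact: open_gt].
- by rewrite /= /f (ger0_norm z0); move: az; rewrite !addrA.
- exists t, z'; split => // y y0; rewrite /= /f (ger0_norm y0) !addrA; exact: ltW.
Qed.

(** The first coordinate T r is positive, so the score increases with y and one parameter serves the
    whole half-line. This replaces an exponential tightness argument. *)
Lemma certified_ge1 : certified [set y | 1 <= y].
Proof.
have [T T0] := Zint_vanish q1 qp (expR_gt0 (growth_rate p - a)).
have [->//|[z zE]] := Zint_pinfty_or_fin q1 qp (T * (p / q), - T).
rewrite zE lte_fin -expRD => hz; exists (T * (p / q), - T), z; split => // y y0 /= y1.
have z0 : 0 < z by rewrite -lte_fin -zE Zint_gt0.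
have h1 : ln z < growth_rate p - a + T * (p / q - 1) by rewrite -[ltRHS]expRK ltr_ln ?posrE ?expR_gt0.
have yq : 1 <= y `^ q by rewrite -(powRr0 y) ler_powR// ltW.
have h2 : T * (p / q) <= T * (p / q) * y `^ q by rewrite ler_peMr// ltW// mulr_gt0// divr_gt0.
by move: h1 h2; rewrite mulrBr mulr1; clear; move: (_ `^ q) (ln z) (growth_rate p) (p / q) => *; lra.
Qed.

Lemma closure_bounded : (forall z, closure A z -> (a%:E < Irate p q z)%E) -> vol_bounded A.
Proof.
move=> HA.
pose D : set R := closure A `&` `[0, 1]%classic.
have cD : compact D.
  apply: (@subclosed_compact R _ (`[0, 1]%classic : set R)).
  - apply: closedI; first exact: closed_closure.
    exact: interval_closed.
  - exact: segment_compact.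
  - by move=> y [].
(* Stated for all z, with [set0] off [D], to obtain a total choice function. *)
have : forall z, exists U : set R, D z -> [/\ open U, U z & certified U].
  move=> z; have [Dz|nDz] := pselect (D z); last by exists set0.
  have [/HA Iz] := Dz; rewrite /= in_itv/= => /andP[z0 _].
  by have [U HU] := certified_near z0 Iz; exists U.
move=> /choice[U HU].
move: cD; rewrite compact_cover => /(_ R D U) [].
- by move=> z /HU[].
- by move=> z Dz; exists z => //; have [] := HU z Dz.
move=> D' D'D DU.
have mU z : D z -> measurable (U z) by move=> /HU[oU _ _]; exact: open_measurable.
pose UU (s : seq R) : set R := [set y | exists2 z, z \in s & U z y].
have HUU (s : seq R) : {subset s <= D} -> measurable (UU s) /\ vol_bounded (UU s).
  elim: s => [_|z s IH sD].
    have -> : UU [::] = set0 by apply/seteqP; split => y // [].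
    split => //; apply: certified_bounded => //.
    (* The empty set is certified vacuously by any parameter with finite Z. *)
    by exists (0, - p^-1), (Cnorm p); split => //; exact: (Zint_Gamma q1 qp).
  have -> : UU (z :: s) = U z `|` UU s.
    apply/seteqP; split => y /=.
      by move=> [w]; rewrite inE => /orP[/eqP->|ws] h; [left|right; exists w].
    by move=> [h|[w ws h]]; [exists z; rewrite ?mem_head|exists w; rewrite // inE ws orbT].
  have [m1 b1] := IH (fun w ws => sD w (mem_behead (s := z :: s) ws)).
  have Dz : D z by apply/set_mem; apply: sD; rewrite mem_head.
  split; first by apply: measurableU => //; exact: mU.
  by apply: vol_boundedU => //; [exact: mU|apply: certified_bounded; [exact: mU|by have [] := HU z Dz]].
have [m1 b1] := HUU (finmap.enum_fset D') (fun z zD => D'D z zD).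
have mge : measurable [set y : R | 1 <= y].
  have -> : [set y : R | 1 <= y] = `[1, +oo[%classic.
    by apply/seteqP; split => x /=; rewrite in_itv/= andbT.
  exact: measurable_itv.
have b2 := certified_bounded mge certified_ge1.
apply: (vol_boundedS mA (measurableU _ _ m1 mge) _ (vol_boundedU m1 mge b1 b2)).
move=> y y0 Ay; have [y1|y1] := leP 1 y; [by right|left].
have [|z zD' Uzy] := DU y; last by exists z.
by split; [exact: subset_closure|rewrite /= in_itv/= y0 ltW].
Qed.

End UpperBound.

Lemma lawZ_upper (A : set R) (a : R) : measurable A ->
    (forall z, closure A z -> (a%:E < Irate p q z)%E) ->
  (limn_esup (fun n => lne (lawZ p q n.+1 A) * (n.+1%:R^-1)%:E) <= (- a)%:E)%E.
Proof.
move=> mA HA; have [C C0 HC] := closure_bounded mA HA.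
apply/lee_addgt0Pr => e e0; rewrite -EFinD; apply: limn_esup_le_near.
(* One half of e pays for the volume of the ball in the denominator, the other for the constant
   [C]. *)
have e2 : 0 < e / 2 by rewrite divr_gt0.
have [N HN] := rescaled_ball_lower q1 qp e2.
exists (maxn N (Num.truncn (C / (e / 2))).+1) => n; rewrite geq_max => /andP[Nn nC].
apply: lne_le_expR; rewrite lawZ_stat//.
have mS := measurable_rescaled_event q n.+1 mA.
have [V V0 VE] := rescaled_ball_fin n.+1.
have := HN n.+1 (leqW Nn); rewrite VE lee_fin /= => VL.
have V1 : 0 < V := lt_le_trans (expR_gt0 _) VL.
have := stat_vol_ge0 p q n.+1 mS; have := HC n.
case: (stat_vol _ _ _ _) => [W|//|//]; rewrite -EFinM !lee_fin => WC W0.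
rewrite ler_pdivrMr//; apply: (le_trans WC).
have CE : C <= expR (n.+1%:R * (e / 2)).
  apply: le_trans (expR_ge1Dx _); apply: (@le_trans _ _ (n.+1%:R * (e / 2))); last by rewrite lerDr.
  rewrite -ler_pdivrMr// ltW//; apply: lt_le_trans (truncnS_gt _) _.
  by rewrite ler_nat (leq_trans nC).
apply: le_trans (ler_wpM2l (expR_ge0 _) VL).
apply: (le_trans (ler_wpM2r (expR_ge0 _) CE)).
rewrite -!expRD ler_expR -!mulrDr ler_wpM2l//; lra.
Qed.

Lemma LDP_lawZ : LDP (fun n => lawZ p q n.+1) (fun n => n.+1%:R) (Irate p q).
Proof.
move=> A mA; split.
  rewrite leeNl; apply: le_ereal_inf_tmp => _ [z Az <-].
  by rewrite leeNl; exact: lawZ_lower.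
set L := limn_esup _; rewrite leeNr.
(* Certificates need a strict inequality, so the bound is proved at real levels below the infimum;
   letting them increase also covers an infinite infimum. *)
suff H (a : R) : (a%:E < ereal_inf (Irate p q @` closure A))%E -> (L <= (- a)%:E)%E.
  case: (ereal_inf _) H => [r||] H.
  - rewrite leeNr; apply/lee_addgt0Pr => e e0; rewrite -EFinN -EFinD.
    have -> : - r + e = - (r - e) by rewrite opprB addrC.
    by apply: H; rewrite lte_fin ltrBlDr ltrDl.
  - suff h : (- L)%E = +oo%E by rewrite -[L]oppeK h.
    apply/eqyP => r r0; rewrite leeNr; apply: H; exact: ltry.
  - by rewrite leNye.
move=> Ha; apply: lawZ_upper => // z Az; apply: (lt_le_trans Ha).
by apply: ereal_inf_lbound; exists z.
Qed.

End LargeDeviations.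

Theorem theorem1p2 (R : realType) (p q : R) :
  1 <= q -> q < p ->
  LDP (fun n => lawZ p q n.+1) (fun n => n.+1%:R) (Irate p q)
  /\ good_rate_function (Irate p q).
Proof. by move=> q1 qp; split; [exact: LDP_lawZ|exact: good_Irate]. Qed.
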